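(* Let $\Phi\in\mathcal{G}_0$ and suppose that $\Phi$ extends holomorphically to a mapping $\mathbb{C}_0\to\mathbb{C}_{\frac12+\epsilon}$ for some $\epsilon>0$. Then $D_\Phi f=f'\circ\Phi$ defines a bounded operator on $\mathcal{H}^2$.
   Context: $\mathbb{C}_\theta=\{s:\Re s>\theta\}$. $\mathcal{H}^2$ is the Hilbert space of Dirichlet series $f(s)=\sum_{n\ge1}a_nn^{-s}$ with $\|f\|_{\mathcal{H}^2}^2=\sum_n|a_n|^2<\infty$. $\mathcal{G}_0$ is the class of maps $\Phi(s)=\sum_{n\ge1}c_nn^{-s}$ where the series converges uniformly in $\mathbb{C}_\eta$ for every $\eta>0$ and $\Phi(\mathbb{C}_0)\subset\mathbb{C}_{1/2}$. *)

(* Defs.v *)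
From Stdlib Require Import Reals.
From Coquelicot Require Import Coquelicot.
Open Scope R_scope.

(* Dirichlet series are indexed by k : nat, the k-th coefficient being the
   coefficient of (k+1)^{-s}; i.e. a_n = a (n-1) for n >= 1. *)

(* n^{-s} = exp(-s log n) = n^{-Re s} (cos(Im s log n) - i sin(Im s log n)) *)
Definition npow_neg (n : nat) (s : C) : C :=
  Cmult (RtoC (exp (- Re s * ln (INR n))))
        (cos (Im s * ln (INR n)), - sin (Im s * ln (INR n))).

Definition dterm (a : nat -> C) (s : C) (k : nat) : C :=
  Cmult (a k) (npow_neg (S k) s).

Fixpoint dpartial (a : nat -> C) (s : C) (N : nat) : C :=
  match N with
  | O => RtoC 0
  | S M => Cplus (dpartial a s M) (dterm a s M)
  end.

(* the sum of the Dirichlet series (meaningful where it converges) *)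
Definition dir_fun (a : nat -> C) (s : C) : C :=
  (Series (fun k => Re (dterm a s k)), Series (fun k => Im (dterm a s k))).

Definition in_H2 (a : nat -> C) : Prop := ex_series (fun k => Cmod (a k) ^ 2).
Definition H2norm (a : nat -> C) : R := sqrt (Series (fun k => Cmod (a k) ^ 2)).

Definition in_G0 (c : nat -> C) (Phi : C -> C) : Prop :=
  (forall eta : R, 0 < eta -> forall e : R, 0 < e ->
     exists N : nat, forall M : nat, (N <= M)%nat ->
       forall s : C, eta < Re s -> Cmod (Cminus (dpartial c s M) (Phi s)) < e)
  /\ (forall s : C, 0 < Re s -> 1/2 < Re (Phi s)).

(* Main.v *)
(* Since [|n^{-Phi(s)}| <= n^{-1/2-eps}] on [Re s > 0], Cauchy-Schwarz bounds
   [f' o Phi] there by [K ||f||] with [K^2 = sum_n (log n)^2 n^{-1-2 eps}]. Moreover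
   [f' o Phi] is, on every half-plane [Re s > eta > 0], a uniform limit of Dirichlet
   polynomials: such limits form an algebra closed under uniform limits, hence under
   [exp], so each [n^{-Phi}] is one. The mean value of [|P|^2] on a vertical line is
   [sum_n |p_n|^2 n^{-2 sigma}], so on Dirichlet polynomials sup norms dominate weighted
   l^2 norms; letting [sigma] tend to 0, the limit [f' o Phi] has coefficients of l^2
   norm at most [K ||f||], and its Dirichlet series represents it on [Re s > 1/2]. *)

Require Import Defs.
From Stdlib Require Import Reals Lra Lia Psatz ClassicalEpsilon.
From Coquelicot Require Import Coquelicot.
Open Scope R_scope.

(** * The complex exponential *)

(** The coefficients of $f'\circ\Phi$ have no usable formula, and the series of $\Phi$ is not
    assumed to converge absolutely, so it cannot be expanded and rearranged. The proof therefore
    handles functions that are uniformly approximable by polynomials, and coefficients reappear only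
    at the end, as limits of the coefficients of the approximants. The exponential enters through
    $(1+z/m)^m$, which uses nothing but constants, sums and products of the algebra. The mean value
    is taken over equally spaced points of a line instead of by integration: two distinct
    frequencies then produce a geometric sum, which stays bounded as the number of points grows. The
    abscissa 1/2 has the same role twice, since $n^{-\sigma}$ is square summable exactly for
    $\sigma>1/2$. At $\Phi(s)$ the margin $\epsilon$ absorbs the factor $\log n$ and makes $K$
    finite; at $s$ it makes the series with the new coefficients converge. The complex derivative of
    $f$ comes from a second-order estimate of each term, summed against one majorant. *)

Lemma im_le_Cmod (z : C) : Rabs (Im z) <= Cmod z.
Proof.
  eapply Rle_trans; [|apply Rmax_Cmod]. apply Rmax_r.
Qed.

Lemma Cmod_le_add (z : C) : Cmod z <= Rabs (Re z) + Rabs (Im z).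
Proof.
  replace z with (RtoC (Re z) + Ci * RtoC (Im z))%C at 1.
  - eapply Rle_trans; [apply Cmod_triangle|].
    rewrite Cmod_mult, Cmod_Ci, !Cmod_R. lra.
  - destruct z; unfold Cplus, Cmult, Ci, RtoC, Re, Im; simpl; f_equal; ring.
Qed.

Lemma Cmod_minus_sym (z w : C) : Cmod (z - w) = Cmod (w - z).
Proof.
  rewrite <- Cmod_opp. f_equal. ring.
Qed.

Lemma Cmod_minus_triangle (x y z : C) : Cmod (x - z) <= Cmod (x - y) + Cmod (y - z).
Proof.
  replace (x - z)%C with ((x - y) + (y - z))%C by ring. apply Cmod_triangle.
Qed.

Lemma Cmod_le_minus (x y : C) : Cmod x <= Cmod y + Cmod (x - y).
Proof.
  replace x with (y + (x - y))%C at 1 by ring. apply Cmod_triangle.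
Qed.

Definition Cexp (z : C) : C := (RtoC (exp (Re z)) * (cos (Im z), sin (Im z)))%C.

Lemma Cexp_plus (z w : C) : Cexp (z + w) = (Cexp z * Cexp w)%C.
Proof.
  destruct z as [x y], w as [u v].
  unfold Cexp, Cplus, Cmult, RtoC, Re, Im; simpl.
  rewrite exp_plus, cos_plus, sin_plus. f_equal; ring.
Qed.

Lemma Cexp_0 : Cexp 0 = 1%C.
Proof.
  unfold Cexp, Re, Im, RtoC, Cmult; simpl.
  rewrite exp_0, cos_0, sin_0. f_equal; ring.
Qed.

Lemma Cmod_Cexp (z : C) : Cmod (Cexp z) = exp (Re z).
Proof.
  unfold Cexp. rewrite Cmod_mult, Cmod_R, Rabs_right by (left; apply exp_pos).
  unfold Cmod; simpl.
  replace (cos (Im z) * (cos (Im z) * 1) + sin (Im z) * (sin (Im z) * 1)) with 1.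
  - rewrite sqrt_1; ring.
  - generalize (sin2_cos2 (Im z)); unfold Rsqr; lra.
Qed.

Lemma npow_neg_Cexp (n : nat) (s : C) : npow_neg n s = Cexp (- s * RtoC (ln (INR n))).
Proof.
  destruct s as [x y].
  unfold npow_neg, Cexp, Cmult, Copp, RtoC, Re, Im; simpl.
  replace (- x * ln (INR n) - - y * 0) with (- x * ln (INR n)) by ring.
  replace (- x * 0 + - y * ln (INR n)) with (- (y * ln (INR n))) by ring.
  rewrite cos_neg, sin_neg. reflexivity.
Qed.

(** Mean value theorem between 0 and x. Each use trades a bound on the derivative for one more
    factor |x|, so first-order estimates yield the second-order ones below. *)
Lemma Rabs_le_of_derive (f df : R -> R) (B x : R) :
  (forall t, is_derive f t (df t)) ->
  f 0 = 0 ->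
  (forall t, Rabs t <= Rabs x -> Rabs (df t) <= B) ->
  Rabs (f x) <= B * Rabs x.
Proof.
  intros Hd H0 HB.
  destruct (MVT_gen f 0 x df) as [c [Hc He]].
  - intros; apply Hd.
  - intros t _. apply continuity_pt_filterlim. apply (ex_derive_continuous f).
    exists (df t); apply Hd.
  - rewrite H0 in He. replace (f x) with (df c * x) by lra.
    rewrite Rabs_mult. apply Rmult_le_compat_r; [apply Rabs_pos|].
    apply HB. revert Hc; unfold Rmin, Rmax, Rabs.
    repeat destruct Rle_dec; repeat destruct Rcase_abs; lra.
Qed.

Lemma Rabs_sin_le (x : R) : Rabs (sin x) <= Rabs x.
Proof.
  rewrite <- (Rmult_1_l (Rabs x)).
  apply (Rabs_le_of_derive sin cos 1).
  - intros t; auto_derive; [easy|ring].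
  - apply sin_0.
  - intros t _. apply Rabs_le. generalize (COS_bound t); lra.
Qed.

Lemma Rabs_cos_minus_1_le (x : R) : Rabs (cos x - 1) <= Rabs x * Rabs x.
Proof.
  apply (Rabs_le_of_derive (fun t => cos t - 1) (fun t => - sin t) (Rabs x)).
  - intros t; auto_derive; [easy|ring].
  - rewrite cos_0; ring.
  - intros t Ht. rewrite Rabs_Ropp. eapply Rle_trans; [apply Rabs_sin_le|easy].
Qed.

Lemma Rabs_sin_minus_id_le (x : R) : Rabs (sin x - x) <= Rabs x * Rabs x.
Proof.
  apply (Rabs_le_of_derive (fun t => sin t - t) (fun t => cos t - 1) (Rabs x)).
  - intros t; auto_derive; [easy|ring].
  - rewrite sin_0; ring.
  - intros t Ht.
    replace (cos t - 1) with (cos t - 1 - 0) by ring.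
    assert (H : Rabs (cos t - 1) <= 1 * Rabs t).
    { apply (Rabs_le_of_derive (fun t => cos t - 1) (fun t => - sin t) 1).
      - intros u; auto_derive; [easy|ring].
      - rewrite cos_0; ring.
      - intros u _. rewrite Rabs_Ropp. apply Rabs_le. generalize (SIN_bound u); lra. }
    rewrite Rminus_0_r. lra.
Qed.

Lemma exp_le_compat (x y : R) : x <= y -> exp x <= exp y.
Proof.
  intros [H| ->]; [left; now apply exp_increasing|right; reflexivity].
Qed.

Lemma Rabs_exp_minus_1_le (x : R) : Rabs (exp x - 1) <= exp (Rabs x) * Rabs x.
Proof.
  apply (Rabs_le_of_derive (fun t => exp t - 1) exp (exp (Rabs x))).
  - intros t; auto_derive; [easy|ring].
  - rewrite exp_0; ring.
  - intros t Ht. rewrite Rabs_right by (left; apply exp_pos).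
    apply exp_le_compat. eapply Rle_trans; [apply Rle_abs|easy].
Qed.

Lemma Rabs_exp_minus_1_id_le (x : R) :
  Rabs (exp x - 1 - x) <= exp (Rabs x) * Rabs x * Rabs x.
Proof.
  apply (Rabs_le_of_derive (fun t => exp t - 1 - t) (fun t => exp t - 1)
           (exp (Rabs x) * Rabs x)).
  - intros t; auto_derive; [easy|ring].
  - rewrite exp_0; ring.
  - intros t Ht. eapply Rle_trans; [apply Rabs_exp_minus_1_le|].
    apply Rmult_le_compat; [left; apply exp_pos|apply Rabs_pos| |easy].
    now apply exp_le_compat.
Qed.

Lemma Cexp_second_order (z : C) :
  Cmod (Cexp z - 1 - z) <= 4 * Cmod z ^ 2 * exp (Cmod z).
Proof.
  eapply Rle_trans; [apply Cmod_le_add|].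
  assert (Hx := re_le_Cmod z). assert (Hy := im_le_Cmod z).
  assert (H1 := Rabs_exp_minus_1_id_le (Re z)).
  assert (H2 := Rabs_exp_minus_1_le (Re z)).
  assert (H3 := Rabs_cos_minus_1_le (Im z)).
  assert (H4 := Rabs_sin_minus_id_le (Im z)).
  assert (H5 := Rabs_sin_le (Im z)).
  assert (H6 : exp (Rabs (Re z)) <= exp (Cmod z)) by now apply exp_le_compat.
  assert (H7 : 1 <= exp (Cmod z)).
  { rewrite <- exp_0. apply exp_le_compat, Cmod_ge_0. }
  assert (H8 : exp (Re z) <= exp (Cmod z)).
  { apply exp_le_compat. eapply Rle_trans; [apply Rle_abs|easy]. }
  assert (Hp := exp_pos (Re z)).
  assert (Hp' := exp_pos (Rabs (Re z))).
  (* Real and imaginary parts split into four real errors, each at most r^2 exp r; hence the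
     constant 4. *)
  replace (Re (Cexp z - 1 - z)) with
    ((exp (Re z) - 1 - Re z) + exp (Re z) * (cos (Im z) - 1))
    by (destruct z; unfold Cexp, Cminus, Cplus, Cmult, Copp, RtoC, Re, Im; simpl; ring).
  replace (Im (Cexp z - 1 - z)) with
    ((exp (Re z) - 1) * sin (Im z) + (sin (Im z) - Im z))
    by (destruct z; unfold Cexp, Cminus, Cplus, Cmult, Copp, RtoC, Re, Im; simpl; ring).
  set (r := Cmod z) in *. set (x := Rabs (Re z)) in *. set (y := Rabs (Im z)) in *.
  assert (0 <= x) by apply Rabs_pos. assert (0 <= y) by apply Rabs_pos.
  assert (Hq : forall a b u v, 0 <= a <= u -> 0 <= b <= v -> a * b <= u * v)
    by (intros; apply Rmult_le_compat; lra).
  assert (HA : exp x * x * x <= exp r * (r * r)).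
  { rewrite Rmult_assoc. apply Hq; [lra|]. split; [nra|apply Hq; lra]. }
  assert (HB : exp (Re z) * Rabs (cos (Im z) - 1) <= exp r * (r * r)).
  { apply Hq; [lra|]. split; [apply Rabs_pos|].
    eapply Rle_trans; [apply H3|apply Hq; lra]. }
  assert (HC : Rabs (exp (Re z) - 1) * Rabs (sin (Im z)) <= exp r * (r * r)).
  { rewrite <- Rmult_assoc. apply Hq.
    - split; [apply Rabs_pos|]. eapply Rle_trans; [apply H2|apply Hq; lra].
    - split; [apply Rabs_pos|lra]. }
  assert (HD : Rabs (sin (Im z) - Im z) <= exp r * (r * r)).
  { eapply Rle_trans; [apply H4|]. rewrite <- (Rmult_1_l (y * y)).
    apply Hq; [lra|]. split; [nra|apply Hq; lra]. }
  assert (T1 := Rabs_triang (exp (Re z) - 1 - Re z) (exp (Re z) * (cos (Im z) - 1))).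
  assert (T2 := Rabs_triang ((exp (Re z) - 1) * sin (Im z)) (sin (Im z) - Im z)).
  rewrite Rabs_mult, (Rabs_right (exp (Re z))) in T1 by lra.
  rewrite Rabs_mult in T2.
  replace (4 * r ^ 2 * exp r) with (4 * (exp r * (r * r))) by ring.
  lra.
Qed.

(** Telescoping of u^m - v^m. Since [1 <= B], the power [B ^ m] can replace the sharper B^(m-1),
    which avoids a predecessor. *)
Lemma Cmod_pow_minus_le (u v : C) (B : R) (m : nat) :
  1 <= B -> Cmod u <= B -> Cmod v <= B ->
  Cmod (u ^ m - v ^ m) <= INR m * Cmod (u - v) * B ^ m.
Proof.
  intros HB Hu Hv. induction m as [|m IH].
  - simpl. replace (1 - 1)%C with (RtoC 0) by ring. rewrite Cmod_0. lra.
  - rewrite S_INR. simpl pow.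
    replace (u ^ S m - v ^ S m)%C with (u ^ m * (u - v) + v * (u ^ m - v ^ m))%C
      by (simpl; ring).
    eapply Rle_trans; [apply Cmod_triangle|]. rewrite !Cmod_mult, Cmod_pow.
    assert (H1 : Cmod u ^ m <= B ^ m) by (apply pow_incr; split; [apply Cmod_ge_0|easy]).
    assert (H2 : 1 <= B ^ m) by now apply pow_R1_Rle.
    assert (H3 := Cmod_ge_0 (u - v)). assert (H4 := Cmod_ge_0 v).
    assert (H5 := Cmod_ge_0 (u ^ m - v ^ m)). assert (H6 := pos_INR m).
    assert (Cmod u ^ m * Cmod (u - v) <= B * B ^ m * Cmod (u - v)).
    { apply Rmult_le_compat_r; nra. }
    assert (Cmod v * Cmod (u ^ m - v ^ m) <= B * (INR m * Cmod (u - v) * B ^ m)).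
    { apply Rmult_le_compat; lra. }
    nra.
Qed.

Lemma Cexp_nat_mult (z : C) (m : nat) : Cexp (RtoC (INR m) * z) = (Cexp z ^ m)%C.
Proof.
  induction m as [|m IH].
  - simpl. rewrite <- Cexp_0. f_equal. ring.
  - rewrite S_INR, RtoC_plus. simpl. rewrite <- IH, <- Cexp_plus. f_equal. ring.
Qed.

Lemma exp_nat_mult (x : R) (m : nat) : exp x ^ m = exp (INR m * x).
Proof.
  induction m as [|m IH].
  - simpl. now rewrite Rmult_0_l, exp_0.
  - rewrite S_INR. simpl. rewrite IH, <- exp_plus. f_equal. ring.
Qed.

(* Second-order Taylor at [z / m], raised to the [m]-th power. *)
Lemma Cexp_euler (z : C) (r : R) (m : nat) :
  Cmod z <= r ->
  Cmod (Cexp z - (1 + RtoC (/ INR (S m)) * z) ^ S m) <= 4 * r ^ 2 * exp (2 * r) / INR (S m).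
Proof.
  intros Hz. set (n := S m).
  assert (Hn : 1 <= INR n) by (unfold n; rewrite S_INR; generalize (pos_INR m); lra).
  assert (Hz0 := Cmod_ge_0 z).
  set (w := (RtoC (/ INR n) * z)%C).
  assert (Hi : 0 < / INR n) by (apply Rinv_0_lt_compat; lra).
  assert (Hw : Cmod w = / INR n * Cmod z).
  { unfold w. rewrite Cmod_mult, Cmod_R, Rabs_right; lra. }
  assert (Hwr : Cmod w <= / INR n * r) by (rewrite Hw; nra).
  assert (Hw0 := Cmod_ge_0 w).
  assert (Hzw : z = (RtoC (INR n) * w)%C).
  { unfold w. rewrite Cmult_assoc, <- RtoC_mult, Rinv_r by lra. ring. }
  rewrite Hzw at 1. rewrite Cexp_nat_mult.
  eapply Rle_trans.
  (* Both bases, [Cexp w] and [1 + w], have modulus at most exp (r / n), whose n-th power is exp r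
     for every n. The n telescoped differences of order 1 / n^2 then add up to order 1 / n. *)
  - apply (Cmod_pow_minus_le _ _ (exp (/ INR n * r))).
    + rewrite <- exp_0 at 1. apply exp_le_compat; lra.
    + rewrite Cmod_Cexp. apply exp_le_compat.
      eapply Rle_trans; [apply Rle_abs|]. eapply Rle_trans; [apply re_le_Cmod|easy].
    + eapply Rle_trans; [apply Cmod_triangle|]. rewrite Cmod_1.
      eapply Rle_trans; [|apply exp_ineq1_le]. lra.
  - rewrite exp_nat_mult, <- Rmult_assoc, Rinv_r, Rmult_1_l by lra.
    assert (H := Cexp_second_order w).
    replace (Cexp w - 1 - w)%C with (Cexp w - (1 + w))%C in H by ring.
    assert (H1 : Cmod (Cexp w - (1 + w)) <= 4 * (/ INR n * r) ^ 2 * exp r).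
    { eapply Rle_trans; [apply H|].
      assert (/ INR n <= 1) by (rewrite <- Rinv_1; apply Rinv_le_contravar; lra).
      apply Rmult_le_compat; [nra|left; apply exp_pos| |apply exp_le_compat; nra].
      apply Rmult_le_compat_l; [lra|]. apply pow_incr; lra. }
    replace (2 * r) with (r + r) by ring. rewrite exp_plus.
    replace (4 * r ^ 2 * (exp r * exp r) / INR n)
      with (INR n * (4 * (/ INR n * r) ^ 2 * exp r) * exp r) by (field; lra).
    apply Rmult_le_compat_r; [left; apply exp_pos|].
    apply Rmult_le_compat_l; lra.
Qed.

(** * Uniform limits of Dirichlet polynomials *)

Fixpoint rsum (f : nat -> R) (N : nat) : R :=
  match N with
  | O => 0
  | S M => rsum f M + f M
  end.

Lemma rsum_le (f g : nat -> R) (N : nat) :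
  (forall k, (k < N)%nat -> f k <= g k) -> rsum f N <= rsum g N.
Proof.
  induction N as [|N IH]; intros H; simpl; [lra|].
  assert (f N <= g N) by (apply H; lia).
  assert (rsum f N <= rsum g N) by (apply IH; intros; apply H; lia). lra.
Qed.

Lemma rsum_ext (f g : nat -> R) (N : nat) :
  (forall k, (k < N)%nat -> f k = g k) -> rsum f N = rsum g N.
Proof.
  intros H. apply Rle_antisym; apply rsum_le; intros; rewrite H; try easy; lra.
Qed.

Lemma rsum_nonneg (f : nat -> R) (N : nat) :
  (forall k, 0 <= f k) -> 0 <= rsum f N.
Proof.
  intros H; induction N as [|N IH]; simpl; [lra|]. generalize (H N); lra.
Qed.

Lemma rsum_incr (f : nat -> R) (N M : nat) :
  (forall k, 0 <= f k) -> (N <= M)%nat -> rsum f N <= rsum f M.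
Proof.
  intros H; induction 1 as [|M _ IH]; simpl; [lra|]. generalize (H M); lra.
Qed.

Lemma rsum_term_le (f : nat -> R) (N k : nat) :
  (forall k, 0 <= f k) -> (k < N)%nat -> f k <= rsum f N.
Proof.
  intros H Hk. assert (H1 := rsum_incr f (S k) N H Hk).
  assert (H2 := rsum_nonneg f k H). simpl in H1. lra.
Qed.

Lemma rsum_scal (c : R) (f : nat -> R) (N : nat) :
  rsum (fun k => c * f k) N = c * rsum f N.
Proof.
  induction N as [|N IH]; simpl; [ring|]. rewrite IH; ring.
Qed.

Definition logS (k : nat) : R := ln (INR (S k)).

Lemma logS_ge_0 (k : nat) : 0 <= logS k.
Proof.
  unfold logS. rewrite <- ln_1. apply ln_le; [lra|].
  rewrite S_INR. generalize (pos_INR k); lra.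
Qed.

Lemma Cmod_npow_neg (k : nat) (s : C) : Cmod (npow_neg (S k) s) = exp (- Re s * logS k).
Proof.
  rewrite npow_neg_Cexp, Cmod_Cexp. f_equal.
  unfold logS; destruct s; unfold Cmult, Copp, RtoC, Re, Im; simpl; ring.
Qed.

Lemma npow_neg_mult (m n : nat) (s : C) :
  (npow_neg (S m) s * npow_neg (S n) s)%C = npow_neg (S m * S n) s.
Proof.
  rewrite !npow_neg_Cexp, <- Cexp_plus. f_equal.
  rewrite mult_INR, ln_mult, RtoC_plus; try (apply lt_0_INR; lia). ring.
Qed.

Lemma Cmod_dterm (a : nat -> C) (s : C) (k : nat) :
  Cmod (dterm a s k) = Cmod (a k) * exp (- Re s * logS k).
Proof.
  unfold dterm. now rewrite Cmod_mult, Cmod_npow_neg.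
Qed.

Lemma Cmod_dpartial_le (a : nat -> C) (s : C) (N : nat) :
  Cmod (dpartial a s N) <= rsum (fun k => Cmod (dterm a s k)) N.
Proof.
  induction N as [|N IH]; simpl; [rewrite Cmod_0; lra|].
  eapply Rle_trans; [apply Cmod_triangle|]. lra.
Qed.

Lemma Cmod_dpartial_minus_le (a : nat -> C) (s : C) (N M : nat) :
  (N <= M)%nat ->
  Cmod (dpartial a s M - dpartial a s N) <=
  rsum (fun k => Cmod (dterm a s k)) M - rsum (fun k => Cmod (dterm a s k)) N.
Proof.
  induction 1 as [|M _ IH]; simpl.
  - unfold Cminus. rewrite Cplus_opp_r, Cmod_0. lra.
  - replace (dpartial a s M + dterm a s M - dpartial a s N)%C
      with (dpartial a s M - dpartial a s N + dterm a s M)%C by ring.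
    eapply Rle_trans; [apply Cmod_triangle|]. lra.
Qed.

Lemma dpartial_ext (p q : nat -> C) (s : C) (N : nat) :
  (forall k, (k < N)%nat -> p k = q k) -> dpartial p s N = dpartial q s N.
Proof.
  induction N as [|N IH]; intros H; simpl; [easy|].
  unfold dterm. rewrite IH, H; [easy|lia|intros; apply H; lia].
Qed.

Lemma dpartial_linear (p q : nat -> C) (u v : C) (s : C) (N : nat) :
  dpartial (fun k => u * p k + v * q k)%C s N
  = (u * dpartial p s N + v * dpartial q s N)%C.
Proof.
  induction N as [|N IH]; simpl; [ring|]. rewrite IH. unfold dterm. ring.
Qed.

Lemma dpartial_minus (p q : nat -> C) (s : C) (N : nat) :
  dpartial (fun k => p k - q k)%C s N = (dpartial p s N - dpartial q s N)%C.
Proof.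
  replace (dpartial p s N - dpartial q s N)%C
    with (1 * dpartial p s N + (-(1)) * dpartial q s N)%C by ring.
  rewrite <- dpartial_linear. apply dpartial_ext; intros; ring.
Qed.

Lemma dpartial_finite_support (p : nat -> C) (s : C) (N M : nat) :
  (forall k, (N <= k)%nat -> p k = 0) -> (N <= M)%nat -> dpartial p s M = dpartial p s N.
Proof.
  intros H; induction 1 as [|M HM IH]; simpl; [easy|].
  rewrite IH. unfold dterm. rewrite H by easy. ring.
Qed.

(** The vanishing of [p] from [N] on lets polynomials of different lengths be padded to a common
    length and combined coefficientwise. *)
Definition dirichlet_poly (f : C -> C) : Prop :=
  exists (p : nat -> C) (N : nat),
    (forall k, (N <= k)%nat -> p k = 0) /\ forall s, f s = dpartial p s N.

Lemma dirichlet_poly_ext (f g : C -> C) :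
  (forall s, f s = g s) -> dirichlet_poly f -> dirichlet_poly g.
Proof.
  intros H [p [N [H0 HN]]]. exists p, N; split; [easy|]. intros s; now rewrite <- H.
Qed.

Lemma dirichlet_poly_dpartial (p : nat -> C) (N : nat) :
  dirichlet_poly (fun s => dpartial p s N).
Proof.
  exists (fun k => if Nat.ltb k N then p k else RtoC 0), N. split.
  - intros k Hk. now rewrite (proj2 (Nat.ltb_ge k N)).
  - intros s. apply dpartial_ext. intros k Hk. now rewrite (proj2 (Nat.ltb_lt k N)).
Qed.

Lemma dirichlet_poly_plus (f g : C -> C) :
  dirichlet_poly f -> dirichlet_poly g -> dirichlet_poly (fun s => f s + g s)%C.
Proof.
  intros [p [N [Hp HN]]] [q [M [Hq HM]]].
  apply (dirichlet_poly_ext (fun s => dpartial (fun k => 1 * p k + 1 * q k)%C s (N + M))).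
  - intros s. rewrite dpartial_linear, HN, HM.
    rewrite (dpartial_finite_support p s N (N + M)), (dpartial_finite_support q s M (N + M));
      try easy; try lia. ring.
  - apply dirichlet_poly_dpartial.
Qed.

Lemma dirichlet_poly_monomial (c : C) (k : nat) :
  dirichlet_poly (fun s => c * npow_neg (S k) s)%C.
Proof.
  set (p := fun j => if Nat.eqb j k then c else RtoC 0).
  apply (dirichlet_poly_ext (fun s => dpartial p s (S k))).
  - intros s. simpl.
    rewrite (dpartial_ext p (fun _ => RtoC 0) s k),
      (dpartial_finite_support _ s 0 k); try easy; try lia.
    + unfold dterm, p; simpl. rewrite Nat.eqb_refl. ring.
    + intros j Hj. unfold p. now rewrite (proj2 (Nat.eqb_neq j k)) by lia.
  - apply dirichlet_poly_dpartial.
Qed.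

Lemma dirichlet_poly_mult_monomial (f : C -> C) (c : C) (k : nat) :
  dirichlet_poly f -> dirichlet_poly (fun s => f s * (c * npow_neg (S k) s))%C.
Proof.
  intros [p [N [_ HN]]].
  apply (dirichlet_poly_ext (fun s => dpartial p s N * (c * npow_neg (S k) s))%C);
    [intros s; now rewrite HN|].
  clear f HN. induction N as [|N IH].
  - apply (dirichlet_poly_ext (fun s => 0 * npow_neg (S k) s)%C);
      [intros s; simpl; ring|apply dirichlet_poly_monomial].
  - eapply dirichlet_poly_ext;
      (* Indices lag the integers by one, so the product of N+1 and k+1 sits at index (N+1)(k+1) - 1
         = k + N(k+1). *)
      [|exact (dirichlet_poly_plus _ _ IH (dirichlet_poly_monomial (p N * c) (k + N * S k)))].
    intros s. simpl. unfold dterm.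
    replace (S (k + N * S k)) with (S N * S k)%nat by lia.
    rewrite <- npow_neg_mult. ring.
Qed.

Lemma dirichlet_poly_mult (f g : C -> C) :
  dirichlet_poly f -> dirichlet_poly g -> dirichlet_poly (fun s => f s * g s)%C.
Proof.
  intros Hf [q [M [_ HM]]].
  apply (dirichlet_poly_ext (fun s => f s * dpartial q s M)%C);
    [intros s; now rewrite HM|].
  clear g HM. induction M as [|M IH].
  - apply (dirichlet_poly_ext (fun s => 0 * npow_neg 1 s)%C);
      [intros s; simpl; ring|apply dirichlet_poly_monomial].
  - eapply dirichlet_poly_ext;
      [|exact (dirichlet_poly_plus _ _ IH (dirichlet_poly_mult_monomial f (q M) M Hf))].
    intros s. simpl. unfold dterm. ring.
Qed.

Lemma dirichlet_poly_bounded (f : C -> C) :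
  dirichlet_poly f -> exists B, forall s, 0 < Re s -> Cmod (f s) <= B.
Proof.
  intros [p [N [_ HN]]]. exists (rsum (fun k => Cmod (p k)) N). intros s Hs.
  rewrite HN. eapply Rle_trans; [apply Cmod_dpartial_le|].
  apply rsum_le. intros k _. rewrite Cmod_dterm.
  rewrite <- (Rmult_1_r (Cmod (p k))) at 2. apply Rmult_le_compat_l; [apply Cmod_ge_0|].
  rewrite <- exp_0. apply exp_le_compat. generalize (logS_ge_0 k); nra.
Qed.

(** The approximant may change with [eta] and [e], and no coefficients are attached to [g]; products
    and exponentials then need no convolution of infinite series. *)
Definition dirichlet_limit (g : C -> C) : Prop :=
  forall eta e : R, 0 < eta -> 0 < e ->
    exists f, dirichlet_poly f /\ forall s, eta < Re s -> Cmod (f s - g s) < e.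

Lemma dirichlet_limit_of_poly (f : C -> C) : dirichlet_poly f -> dirichlet_limit f.
Proof.
  intros Hf eta e _ He. exists f; split; [easy|].
  intros s _. unfold Cminus. now rewrite Cplus_opp_r, Cmod_0.
Qed.

Lemma dirichlet_limit_const (c : C) : dirichlet_limit (fun _ => c).
Proof.
  apply dirichlet_limit_of_poly. eapply dirichlet_poly_ext; [|apply (dirichlet_poly_monomial c 0)].
  intros s. cbv beta. rewrite npow_neg_Cexp. simpl. rewrite ln_1.
  replace (- s * 0)%C with (RtoC 0) by ring. rewrite Cexp_0. ring.
Qed.

Lemma dirichlet_limit_bounded (g : C -> C) (eta : R) :
  0 < eta -> dirichlet_limit g -> exists B, forall s, eta < Re s -> Cmod (g s) <= B.
Proof.
  intros Heta Hg. destruct (Hg eta 1 Heta Rlt_0_1) as [f [Hf Hfg]].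
  destruct (dirichlet_poly_bounded f Hf) as [B HB]. exists (B + 1). intros s Hs.
  eapply Rle_trans; [apply (Cmod_le_minus _ (f s))|].
  rewrite (Cmod_minus_sym (g s)). generalize (HB s), (Hfg s Hs). lra.
Qed.

Lemma dirichlet_limit_closed (g : C -> C) :
  (forall eta e, 0 < eta -> 0 < e ->
     exists h, dirichlet_limit h /\ forall s, eta < Re s -> Cmod (h s - g s) < e) ->
  dirichlet_limit g.
Proof.
  intros H eta e Heta He.
  destruct (H eta (e / 2) Heta ltac:(lra)) as [h [Hh Hhg]].
  destruct (Hh eta (e / 2) Heta ltac:(lra)) as [f [Hf Hfh]].
  exists f; split; [easy|]. intros s Hs.
  eapply Rle_lt_trans; [apply (Cmod_minus_triangle _ (h s))|].
  generalize (Hhg s Hs), (Hfh s Hs). lra.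
Qed.

Lemma dirichlet_limit_plus (g h : C -> C) :
  dirichlet_limit g -> dirichlet_limit h -> dirichlet_limit (fun s => g s + h s)%C.
Proof.
  intros Hg Hh eta e Heta He.
  destruct (Hg eta (e / 2) Heta ltac:(lra)) as [f [Hf Hfg]].
  destruct (Hh eta (e / 2) Heta ltac:(lra)) as [k [Hk Hkh]].
  exists (fun s => f s + k s)%C; split; [now apply dirichlet_poly_plus|]. intros s Hs.
  replace (f s + k s - (g s + h s))%C with ((f s - g s) + (k s - h s))%C by ring.
  eapply Rle_lt_trans; [apply Cmod_triangle|].
  generalize (Hfg s Hs), (Hkh s Hs). lra.
Qed.

Lemma dirichlet_limit_mult (g h : C -> C) :
  dirichlet_limit g -> dirichlet_limit h -> dirichlet_limit (fun s => g s * h s)%C.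
Proof.
  intros Hg Hh eta e Heta He.
  destruct (dirichlet_limit_bounded g eta Heta Hg) as [B HB].
  set (B' := Rabs B + 1). assert (HB' : 0 < B') by (unfold B'; generalize (Rabs_pos B); lra).
  destruct (Hh eta (e / (2 * B')) Heta) as [k [Hk Hkh]].
  { apply Rdiv_lt_0_compat; lra. }
  (* The error [f s - g s] is multiplied by [k s], so [f] can be chosen only once [k] is fixed and
     bounded. *)
  destruct (dirichlet_poly_bounded k Hk) as [D HD].
  set (D' := Rabs D + 1). assert (HD' : 0 < D') by (unfold D'; generalize (Rabs_pos D); lra).
  destruct (Hg eta (e / (2 * D')) Heta) as [f [Hf Hfg]].
  { apply Rdiv_lt_0_compat; lra. }
  exists (fun s => f s * k s)%C; split; [now apply dirichlet_poly_mult|]. intros s Hs.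
  replace (f s * k s - g s * h s)%C with ((f s - g s) * k s + g s * (k s - h s))%C by ring.
  eapply Rle_lt_trans; [apply Cmod_triangle|]. rewrite !Cmod_mult.
  assert (H1 : Cmod (k s) <= D').
  { eapply Rle_trans; [apply HD; lra|]. unfold D'. generalize (Rle_abs D); lra. }
  assert (H2 : Cmod (g s) <= B').
  { eapply Rle_trans; [apply HB; lra|]. unfold B'. generalize (Rle_abs B); lra. }
  assert (H3 := Hfg s Hs). assert (H4 := Hkh s Hs).
  assert (Cmod (f s - g s) * Cmod (k s) <= Cmod (f s - g s) * D')
    by (apply Rmult_le_compat_l; [apply Cmod_ge_0|easy]).
  assert (Cmod (g s) * Cmod (k s - h s) <= B' * Cmod (k s - h s))
    by (apply Rmult_le_compat_r; [apply Cmod_ge_0|easy]).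
  assert (Cmod (f s - g s) * D' < e / (2 * D') * D') by now apply Rmult_lt_compat_r.
  assert (B' * Cmod (k s - h s) < B' * (e / (2 * B'))) by now apply Rmult_lt_compat_l.
  replace (e / (2 * D') * D') with (e / 2) in * by (field; lra).
  replace (B' * (e / (2 * B'))) with (e / 2) in * by (field; lra).
  lra.
Qed.

Lemma dirichlet_limit_pow (g : C -> C) (m : nat) :
  dirichlet_limit g -> dirichlet_limit (fun s => g s ^ m)%C.
Proof.
  intros Hg. induction m as [|m IH]; simpl.
  - apply dirichlet_limit_const.
  - now apply dirichlet_limit_mult.
Qed.

(** On each half-plane [g] is bounded by some [B], so the error of Euler's approximation depends
    only on [B] and the exponent, not on [s]. *)
Lemma dirichlet_limit_Cexp (g : C -> C) :
  dirichlet_limit g -> dirichlet_limit (fun s => Cexp (g s)).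
Proof.
  intros Hg. apply dirichlet_limit_closed. intros eta e Heta He.
  destruct (dirichlet_limit_bounded g eta Heta Hg) as [B HB].
  set (K := 4 * B ^ 2 * exp (2 * B)).
  assert (HK : 0 <= K).
  { unfold K. apply Rmult_le_pos; [nra|left; apply exp_pos]. }
  destruct (nfloor_ex (K / e)) as [m [_ Hm]].
  { apply Rmult_le_pos; [easy|]. left; now apply Rinv_0_lt_compat. }
  exists (fun s => (1 + RtoC (/ INR (S m)) * g s) ^ S m)%C. split.
  - apply dirichlet_limit_pow, dirichlet_limit_plus;
      [apply dirichlet_limit_const|apply dirichlet_limit_mult; [apply dirichlet_limit_const|easy]].
  - intros s Hs. rewrite Cmod_minus_sym.
    eapply Rle_lt_trans; [apply (Cexp_euler _ B), HB, Hs|]. fold K.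
    assert (0 < INR (S m)) by (apply lt_0_INR; lia).
    rewrite <- S_INR in Hm. apply Rmult_lt_reg_r with (INR (S m)); [easy|].
    unfold Rdiv. rewrite Rmult_assoc, Rinv_l, Rmult_1_r by lra.
    apply Rmult_lt_reg_r with (/ e); [now apply Rinv_0_lt_compat|].
    replace (e * INR (S m) * / e) with (INR (S m)) by (field; lra). exact Hm.
Qed.

Lemma dirichlet_limit_dpartial_comp (a : nat -> C) (Phi : C -> C) (N : nat) :
  dirichlet_limit Phi -> dirichlet_limit (fun s => dpartial a (Phi s) N).
Proof.
  intros HPhi. induction N as [|N IH]; simpl; [apply dirichlet_limit_const|].
  apply dirichlet_limit_plus; [easy|]. unfold dterm.
  apply dirichlet_limit_mult; [apply dirichlet_limit_const|].
  intros eta e Heta He.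
  destruct (dirichlet_limit_Cexp (fun s => RtoC (- logS N) * Phi s)%C) with eta e as [f Hf];
    [apply dirichlet_limit_mult; [apply dirichlet_limit_const|easy]|easy|easy|].
  exists f; split; [apply Hf|]. intros s Hs. rewrite npow_neg_Cexp.
  replace (- Phi s * RtoC (ln (INR (S N))))%C with (RtoC (- logS N) * Phi s)%C
    by (unfold logS; rewrite RtoC_opp; ring).
  now apply Hf.
Qed.

Lemma in_G0_dirichlet_limit (c : nat -> C) (Phi : C -> C) :
  in_G0 c Phi -> dirichlet_limit Phi.
Proof.
  intros [H _] eta e Heta He. destruct (H eta Heta e He) as [N HN].
  exists (fun s => dpartial c s N). split; [apply dirichlet_poly_dpartial|].
  intros s Hs. now apply (HN N).
Qed.

(** * Mean values on vertical lines *)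

Fixpoint csum (f : nat -> C) (N : nat) : C :=
  match N with
  | O => RtoC 0
  | S M => (csum f M + f M)%C
  end.

Lemma csum_ext (f g : nat -> C) (N : nat) : (forall k, f k = g k) -> csum f N = csum g N.
Proof.
  intros H; induction N as [|N IH]; simpl; [easy|]. now rewrite IH, H.
Qed.

Lemma csum_plus (f g : nat -> C) (N : nat) :
  csum (fun k => f k + g k)%C N = (csum f N + csum g N)%C.
Proof.
  induction N as [|N IH]; simpl; [ring|]. rewrite IH; ring.
Qed.

Lemma csum_scal (c : C) (f : nat -> C) (N : nat) :
  csum (fun k => c * f k)%C N = (c * csum f N)%C.
Proof.
  induction N as [|N IH]; simpl; [ring|]. rewrite IH; ring.
Qed.

Lemma Re_csum (f : nat -> C) (N : nat) : Re (csum f N) = rsum (fun k => Re (f k)) N.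
Proof.
  induction N as [|N IH]; simpl; [easy|]. now rewrite <- IH.
Qed.

Lemma csum_geometric_bound (z : C) (N : nat) :
  Cmod z = 1 -> z <> 1%C -> Cmod (csum (fun j => z ^ j)%C N) <= 2 / Cmod (z - 1).
Proof.
  intros Hz Hz1.
  assert (Hne : (z - 1)%C <> 0).
  { intros H. apply Hz1. replace z with ((z - 1) + 1)%C by ring. rewrite H. ring. }
  assert (Hpos : 0 < Cmod (z - 1)) by now apply Cmod_gt_0.
  assert (Heq : (csum (fun j => z ^ j) N * (z - 1) = z ^ N - 1)%C).
  { clear. induction N as [|N IH]; simpl; [ring|].
    rewrite Cmult_plus_distr_r, IH. ring. }
  apply Rmult_le_reg_r with (Cmod (z - 1)); [easy|].
  rewrite <- Cmod_mult, Heq.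
  replace (2 / Cmod (z - 1) * Cmod (z - 1)) with 2 by (field; lra).
  unfold Cminus. eapply Rle_trans; [apply Cmod_triangle|].
  rewrite Cmod_opp, Cmod_1, Cmod_pow, Hz, pow1. lra.
Qed.

Lemma Cconj_Cexp (z : C) : Cconj (Cexp z) = Cexp (Cconj z).
Proof.
  destruct z as [x y]. unfold Cexp, Cconj, Cmult, RtoC, Re, Im; simpl.
  rewrite cos_neg, sin_neg. f_equal; ring.
Qed.

Lemma Cmod_sq_plus (x y : C) :
  Cmod (x + y) ^ 2 = Cmod x ^ 2 + Cmod y ^ 2 + 2 * Re (x * Cconj y).
Proof.
  rewrite !Cmod2_alt. destruct x, y.
  unfold Cplus, Cmult, Cconj, Re, Im; simpl; ring.
Qed.

(** Averages over the first J of these points, with J growing, replace the integral mean over the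
    line Re s = sigma. *)
Definition sample (sigma : R) (N j : nat) : C := (sigma, INR j / INR (S N)).

(* For [m <> n] the step [1 / (N + 1)] keeps the frequency difference in
   [(-1, 1)] and nonzero, so the samples form a geometric progression of
   ratio different from 1. *)
Lemma cross_term_bounded (p : nat -> C) (sigma : R) (N m n : nat) :
  (m < n)%nat -> (n <= N)%nat ->
  exists D, forall J,
    Cmod (csum (fun j => let s := sample sigma N j in
                         dterm p s m * Cconj (dterm p s n))%C J) <= D.
Proof.
  intros Hmn HnN.
  set (h := / INR (S N)). set (th := h * (logS n - logS m)).
  set (z := Cexp (0, th)).
  set (c := (p m * Cconj (p n) * RtoC (exp (- sigma * (logS m + logS n))))%C).
  assert (Hh : 0 < h) by (apply Rinv_0_lt_compat, lt_0_INR; lia).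
  assert (Hth : 0 < th < 1).
  { unfold th. split.
    - apply Rmult_lt_0_compat; [easy|]. unfold logS.
      assert (ln (INR (S m)) < ln (INR (S n)))
        by (apply ln_increasing; [apply lt_0_INR|apply lt_INR]; lia). lra.
    - assert (logS n < INR (S N)).
      { unfold logS. assert (ln (INR (S n)) < INR (S n)).
        { rewrite <- (ln_exp (INR (S n))) at 2.
          apply ln_increasing; [apply lt_0_INR; lia|].
          eapply Rlt_le_trans; [|apply exp_ineq1_le]. lra. }
        assert (INR (S n) <= INR (S N)) by (apply le_INR; lia). lra. }
      assert (0 <= logS m) by apply logS_ge_0.
      replace 1 with (h * INR (S N)) by (unfold h; field; apply not_0_INR; lia).
      apply Rmult_lt_compat_l; lra. }
  assert (Hz1 : z <> 1%C).
  { intros H. assert (Him : Im z = 0) by now rewrite H.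
    unfold z, Cexp, Cmult, RtoC, Re, Im in Him; simpl in Him.
    rewrite exp_0 in Him. assert (0 < sin th).
    { apply sin_gt_0; [lra|]. generalize PI2_3_2; lra. }
    lra. }
  assert (Hz : Cmod z = 1) by (unfold z; rewrite Cmod_Cexp; simpl; apply exp_0).
  exists (Cmod c * (2 / Cmod (z - 1))). intros J.
  rewrite (csum_ext _ (fun j => c * z ^ j)%C).
  - rewrite csum_scal, Cmod_mult.
    apply Rmult_le_compat_l; [apply Cmod_ge_0|]. now apply csum_geometric_bound.
  - intros j. cbv zeta. unfold dterm. rewrite Cmult_conj, !npow_neg_Cexp, Cconj_Cexp.
    unfold z. rewrite <- Cexp_nat_mult. unfold c.
    replace (RtoC (exp (- sigma * (logS m + logS n)))) with (Cexp (RtoC (- sigma * (logS m + logS n)))).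
    2:{ unfold Cexp, Cmult, RtoC, Re, Im; simpl. rewrite cos_0, sin_0. f_equal; ring. }
    rewrite <- (Cmult_assoc (p m * Cconj (p n))), <- Cexp_plus.
    transitivity (p m * Cconj (p n) *
      (Cexp (- (sample sigma N j) * RtoC (ln (INR (S m)))) *
       Cexp (Cconj (- (sample sigma N j) * RtoC (ln (INR (S n)))))))%C; [ring|].
    rewrite <- Cexp_plus. f_equal. f_equal.
    unfold sample, th, h, logS, Cplus, Copp, Cmult, Cconj, RtoC; simpl. f_equal; unfold Rdiv; ring.
Qed.

Lemma cross_sum_bounded (p : nat -> C) (sigma : R) (N n M : nat) :
  (n <= N)%nat -> (M <= n)%nat ->
  exists D, forall J,
    Cmod (csum (fun j => let s := sample sigma N j in
                         dpartial p s M * Cconj (dterm p s n))%C J) <= D.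
Proof.
  intros HnN. induction M as [|M IH]; intros HM.
  - exists 0. intros J. rewrite (csum_ext _ (fun _ => 0 * 0)%C).
    + rewrite csum_scal, Cmult_0_l, Cmod_0. lra.
    + intros j. simpl. ring.
  - destruct IH as [D1 H1]; [lia|].
    destruct (cross_term_bounded p sigma N M n HM HnN) as [D2 H2].
    exists (D1 + D2). intros J. specialize (H1 J). specialize (H2 J). cbv zeta in *.
    rewrite (csum_ext _ (fun j =>
      dpartial p (sample sigma N j) M * Cconj (dterm p (sample sigma N j) n) +
      dterm p (sample sigma N j) M * Cconj (dterm p (sample sigma N j) n))%C).
    + rewrite csum_plus. eapply Rle_trans; [apply Cmod_triangle|]. lra.
    + intros j. simpl dpartial. ring.
Qed.

(** Adding one term to the polynomial adds its squared modulus, which is the same at all samples and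
    contributes J copies, and a cross sum that is bounded in J. The main part grows linearly in J
    while the error does not. *)
Lemma sampled_mean_square (p : nat -> C) (sigma : R) (N M : nat) :
  (M <= N)%nat ->
  exists D, forall J,
    Rabs (rsum (fun j => Cmod (dpartial p (sample sigma N j) M) ^ 2) J
          - INR J * rsum (fun k => (Cmod (p k) * exp (- sigma * logS k)) ^ 2) M) <= D.
Proof.
  induction M as [|M IH]; intros HM.
  - exists 0. intros J. simpl. rewrite (rsum_ext _ (fun _ => 0 * 0)).
    + rewrite rsum_scal. rewrite Rmult_0_l, Rmult_0_r, Rminus_0_r, Rabs_R0. lra.
    + intros; rewrite Cmod_0; ring.
  - destruct IH as [D1 H1]; [lia|].
    destruct (cross_sum_bounded p sigma N M M) as [D2 H2]; [lia|lia|].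
    exists (D1 + 2 * D2). intros J. specialize (H1 J). specialize (H2 J). cbv zeta in H2.
    assert (H3 := Rle_trans _ _ _ (re_le_Cmod _) H2). rewrite Re_csum in H3.
    match type of H1 with Rabs ?x <= _ => set (X := x) in * end.
    match type of H3 with Rabs ?x <= _ => set (Y := x) in * end.
    match goal with |- Rabs ?x <= _ => replace x with (X + 2 * Y) end.
    + eapply Rle_trans; [apply Rabs_triang|]. rewrite Rabs_mult, (Rabs_right 2); lra.
    + unfold X, Y; clear. induction J as [|J IH]; [cbn [rsum]; simpl INR; ring|].
      rewrite S_INR. cbn [rsum dpartial] in *.
      rewrite Cmod_sq_plus, Cmod_dterm.
      replace (Re (sample sigma N J)) with sigma by easy.
      lra.
Qed.

Lemma mean_square_le (p : nat -> C) (sigma B : R) (N : nat) :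
  (forall s, Re s = sigma -> Cmod (dpartial p s N) <= B) ->
  rsum (fun k => (Cmod (p k) * exp (- sigma * logS k)) ^ 2) N <= B ^ 2.
Proof.
  intros HB. destruct (sampled_mean_square p sigma N N (le_n _)) as [D HD].
  set (X := rsum _ N) in *.
  apply Rnot_lt_le. intros Hlt.
  (* The J samples contribute at most J B^2 in total; a positive gap X - B^2 would make the left
     side unbounded in J. *)
  assert (HX : forall J, INR J * (X - B ^ 2) <= D).
  { intros J. specialize (HD J).
    assert (H : rsum (fun j => Cmod (dpartial p (sample sigma N j) N) ^ 2) J
                <= INR J * B ^ 2).
    { clear HD. induction J as [|J IH]; [simpl; lra|]. rewrite S_INR. cbn [rsum].
      assert (Cmod (dpartial p (sample sigma N J) N) ^ 2 <= B ^ 2).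
      { apply pow_incr. split; [apply Cmod_ge_0|]. now apply HB. }
      lra. }
    apply Rabs_le_between in HD. lra. }
  assert (HD0 : 0 <= D) by (generalize (HX 0%nat); simpl; lra).
  destruct (nfloor_ex (D / (X - B ^ 2))) as [J [_ HJ]].
  { apply Rmult_le_pos; [easy|]. left; apply Rinv_0_lt_compat; lra. }
  specialize (HX (S J)). rewrite S_INR in HX.
  apply (Rmult_lt_compat_r (X - B ^ 2)) in HJ; [|lra].
  replace (D / (X - B ^ 2) * (X - B ^ 2)) with D in HJ by (field; lra). lra.
Qed.

(** * Series with nonnegative terms *)

Lemma rsum_sum_n (f : nat -> R) (N : nat) : sum_n f N = rsum f (S N).
Proof.
  induction N as [|N IH].
  - rewrite sum_O. simpl. ring.
  - rewrite sum_Sn, IH. reflexivity.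
Qed.

Lemma is_lim_seq_rsum_series (f : nat -> R) :
  ex_series f -> is_lim_seq (rsum f) (Series f).
Proof.
  intros H. apply is_lim_seq_incr_1.
  apply (is_lim_seq_ext (sum_n f)); [apply rsum_sum_n|].
  exact (Series_correct f H).
Qed.

Lemma Series_of_rsum_lim (f : nat -> R) (l : R) : is_lim_seq (rsum f) l -> Series f = l.
Proof.
  intros H. apply is_series_unique.
  apply is_lim_seq_incr_1 in H.
  apply (is_lim_seq_ext _ (sum_n f)) in H; [exact H|].
  intros n; now rewrite rsum_sum_n.
Qed.

Lemma rsum_le_Series (f : nat -> R) (N : nat) :
  (forall k, 0 <= f k) -> ex_series f -> rsum f N <= Series f.
Proof.
  intros H0 H. apply (is_lim_seq_incr_compare (rsum f)).
  - now apply is_lim_seq_rsum_series.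
  - intros n; simpl. generalize (H0 n); lra.
Qed.

Lemma ex_series_rsum_bounded (f : nat -> R) (B : R) :
  (forall k, 0 <= f k) -> (forall N, rsum f N <= B) -> ex_series f /\ Series f <= B.
Proof.
  intros H0 HB. destruct (ex_finite_lim_seq_incr (rsum f) B) as [l Hl]; [|easy|].
  - intros n; simpl. generalize (H0 n); lra.
  - split.
    + exists l. apply is_lim_seq_incr_1 in Hl.
      apply (is_lim_seq_ext _ (sum_n f)) in Hl; [exact Hl|].
      intros n; now rewrite rsum_sum_n.
    + rewrite (Series_of_rsum_lim f l Hl).
      exact (is_lim_seq_le _ _ l B HB Hl (is_lim_seq_const B)).
Qed.

Lemma sq_le_inv (x y : R) : 0 <= y -> x ^ 2 <= y ^ 2 -> x <= y.
Proof.
  intros Hy H. apply Rnot_lt_le. intros Hlt. nra.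
Qed.

Lemma rsum_cauchy_schwarz (x y : nat -> R) (N : nat) :
  rsum (fun k => x k * y k) N ^ 2
  <= rsum (fun k => x k ^ 2) N * rsum (fun k => y k ^ 2) N.
Proof.
  induction N as [|N IH]; cbn [rsum]; [lra|].
  assert (HX : 0 <= rsum (fun k => x k ^ 2) N) by (apply rsum_nonneg; intros; apply pow2_ge_0).
  assert (HY : 0 <= rsum (fun k => y k ^ 2) N) by (apply rsum_nonneg; intros; apply pow2_ge_0).
  set (A := rsum (fun k => x k * y k) N) in *.
  set (X := rsum (fun k => x k ^ 2) N) in *. set (Y := rsum (fun k => y k ^ 2) N) in *.
  set (u := x N). set (v := y N).
  (* Compare squares: 4 A^2 u^2 v^2 <= 4 (X v^2)(Y u^2) <= (X v^2 + Y u^2)^2, by induction and the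
     arithmetic-geometric mean inequality. *)
  assert (H : 2 * A * (u * v) <= X * v ^ 2 + Y * u ^ 2).
  { apply sq_le_inv; [nra|].
    assert (0 <= (X * v ^ 2 - Y * u ^ 2) ^ 2) by apply pow2_ge_0.
    assert (A ^ 2 * (u * v) ^ 2 <= X * Y * (u * v) ^ 2) by (apply Rmult_le_compat_r; [apply pow2_ge_0|exact IH]).
    nra. }
  nra.
Qed.

Lemma rsum_prod_le (x y : nat -> R) (A B : R) (N : nat) :
  0 <= A -> 0 <= B ->
  rsum (fun k => x k ^ 2) N <= A ^ 2 -> rsum (fun k => y k ^ 2) N <= B ^ 2 ->
  rsum (fun k => x k * y k) N <= A * B.
Proof.
  intros HA HB HX HY. apply sq_le_inv; [nra|].
  eapply Rle_trans; [apply rsum_cauchy_schwarz|].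
  rewrite Rpow_mult_distr. apply Rmult_le_compat; try easy;
    apply rsum_nonneg; intros; apply pow2_ge_0.
Qed.

Lemma exp_neg_logS (k : nat) : exp (- logS k) = / INR (S k).
Proof.
  unfold logS. rewrite exp_Ropp, exp_ln; [easy|apply lt_0_INR; lia].
Qed.

(** This follows from exp (-u) >= 1 - u at u = 1 / (k+2), and is the step that makes the zeta series
    telescope. *)
Lemma logS_increment (k : nat) : / INR (S (S k)) <= logS (S k) - logS k.
Proof.
  apply Rnot_lt_le. intros H. apply exp_increasing in H.
  assert (H1 := exp_ineq1_le (- / INR (S (S k)))).
  rewrite exp_Ropp in H1.
  assert (H2 : exp (logS (S k) - logS k) = INR (S (S k)) / INR (S k)).
  { unfold Rminus. rewrite exp_plus, exp_neg_logS. unfold logS at 1.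
    rewrite exp_ln by (apply lt_0_INR; lia). easy. }
  assert (H3 : 0 < INR (S k)) by (apply lt_0_INR; lia).
  rewrite H2 in H. rewrite (S_INR (S k)) in *. set (x := INR (S k)) in *.
  apply Rinv_lt_contravar in H; [|apply Rmult_lt_0_compat; [apply Rdiv_lt_0_compat; lra|apply exp_pos]].
  replace (/ ((x + 1) / x)) with (1 + - / (x + 1)) in H by (field; lra). lra.
Qed.

(** Integral test in discrete form: n^(-1-d) <= ((n-1)^(-d) - n^(-d)) / d for n >= 2, and the right
    side telescopes, so the partial sums stay below 1 + 1/d. *)
Lemma zeta_series (d : R) : 0 < d -> ex_series (fun k => exp (- (1 + d) * logS k)).
Proof.
  intros Hd.
  assert (Hstep : forall k,
    d * exp (- (1 + d) * logS (S k)) <= exp (- d * logS k) - exp (- d * logS (S k))).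
  { intros k.
    replace (- (1 + d) * logS (S k)) with (- d * logS (S k) + - logS (S k)) by ring.
    replace (- d * logS k) with (- d * logS (S k) + d * (logS (S k) - logS k)) by ring.
    rewrite !exp_plus, exp_neg_logS.
    assert (H1 := exp_ineq1_le (d * (logS (S k) - logS k))).
    assert (H2 := logS_increment k). assert (H3 := exp_pos (- d * logS (S k))).
    assert (H4 : d * / INR (S (S k)) <= exp (d * (logS (S k) - logS k)) - 1) by nra.
    nra. }
  apply (ex_series_rsum_bounded _ (1 + / d)); [intros; left; apply exp_pos|].
  assert (H : forall N, rsum (fun k => exp (- (1 + d) * logS k)) (S N)
                        <= 1 + (1 - exp (- d * logS N)) / d).
  { induction N as [|N IH].
    - simpl. unfold logS; simpl. rewrite ln_1, !Rmult_0_r, exp_0. unfold Rdiv. lra.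
    - cbn [rsum] in *. specialize (Hstep N).
      assert (exp (- (1 + d) * logS (S N)) <= (exp (- d * logS N) - exp (- d * logS (S N))) / d).
      { apply Rmult_le_reg_l with d; [easy|].
        replace (d * ((exp (- d * logS N) - exp (- d * logS (S N))) / d))
          with (exp (- d * logS N) - exp (- d * logS (S N))) by (field; lra). easy. }
      unfold Rdiv in *. lra. }
  intros N. eapply Rle_trans; [apply (rsum_incr _ N (S N));
    [intros; left; apply exp_pos|lia]|].
  eapply Rle_trans; [apply H|].
  assert (0 < / d) by now apply Rinv_0_lt_compat. assert (H5 := exp_pos (- d * logS N)).
  unfold Rdiv. nra.
Qed.

(** * Bounded limits of Dirichlet polynomials have square-summable coefficients *)

Definition Clim (u : nat -> C) (l : C) : Prop :=
  forall e, 0 < e -> exists N, forall n, (N <= n)%nat -> Cmod (u n - l) < e.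

Lemma is_lim_seq_of_dist (u : nat -> R) (v : nat -> C) (l : R) (m : C) :
  (forall n, Rabs (u n - l) <= Cmod (v n - m)) -> Clim v m -> is_lim_seq u l.
Proof.
  intros H Hv. apply is_lim_seq_spec. intros e.
  destruct (Hv e (cond_pos e)) as [N HN]. exists N. intros n Hn.
  eapply Rle_lt_trans; [apply H|]. now apply HN.
Qed.

Lemma Re_Clim (u : nat -> C) (l : C) : Clim u l -> is_lim_seq (fun n => Re (u n)) (Re l).
Proof.
  apply is_lim_seq_of_dist. intros n. exact (re_le_Cmod (u n - l)).
Qed.

Lemma Im_Clim (u : nat -> C) (l : C) : Clim u l -> is_lim_seq (fun n => Im (u n)) (Im l).
Proof.
  apply is_lim_seq_of_dist. intros n. exact (im_le_Cmod (u n - l)).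
Qed.

Lemma Cmod_Clim (u : nat -> C) (l : C) : Clim u l -> is_lim_seq (fun n => Cmod (u n)) (Cmod l).
Proof.
  apply is_lim_seq_of_dist. intros n. apply Rabs_le.
  generalize (Cmod_le_minus (u n) l), (Cmod_le_minus l (u n)).
  rewrite (Cmod_minus_sym l). lra.
Qed.

Lemma Clim_of_Re_Im (u : nat -> C) (x y : R) :
  is_lim_seq (fun n => Re (u n)) x -> is_lim_seq (fun n => Im (u n)) y -> Clim u (x, y).
Proof.
  intros Hx Hy e He. apply is_lim_seq_spec in Hx. apply is_lim_seq_spec in Hy.
  destruct (Hx (mkposreal (e / 2) ltac:(lra))) as [N HN].
  destruct (Hy (mkposreal (e / 2) ltac:(lra))) as [M HM]. simpl in *.
  exists (N + M)%nat. intros n Hn. eapply Rle_lt_trans; [apply Cmod_le_add|].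
  specialize (HN n ltac:(lia)). specialize (HM n ltac:(lia)).
  change (Rabs (Re (u n) - x) + Rabs (Im (u n) - y) < e). lra.
Qed.

Lemma Clim_cauchy (u : nat -> C) :
  (forall e, 0 < e -> exists N, forall n m, (N <= n)%nat -> (N <= m)%nat -> Cmod (u n - u m) < e) ->
  exists l, Clim u l.
Proof.
  intros H.
  assert (Hx : ex_finite_lim_seq (fun n => Re (u n))).
  { apply ex_lim_seq_cauchy_corr. intros e. destruct (H e (cond_pos e)) as [N HN].
    exists N. intros n m Hn Hm.
    eapply Rle_lt_trans; [exact (re_le_Cmod (u n - u m))|now apply HN]. }
  assert (Hy : ex_finite_lim_seq (fun n => Im (u n))).
  { apply ex_lim_seq_cauchy_corr. intros e. destruct (H e (cond_pos e)) as [N HN].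
    exists N. intros n m Hn Hm.
    eapply Rle_lt_trans; [exact (im_le_Cmod (u n - u m))|now apply HN]. }
  destruct Hx as [x Hx], Hy as [y Hy]. exists (x, y). now apply Clim_of_Re_Im.
Qed.

Lemma Re_dpartial (a : nat -> C) (s : C) (N : nat) :
  Re (dpartial a s N) = rsum (fun k => Re (dterm a s k)) N.
Proof.
  induction N as [|N IH]; cbn [dpartial rsum]; [easy|]. now rewrite <- IH.
Qed.

Lemma Im_dpartial (a : nat -> C) (s : C) (N : nat) :
  Im (dpartial a s N) = rsum (fun k => Im (dterm a s k)) N.
Proof.
  induction N as [|N IH]; cbn [dpartial rsum]; [easy|]. now rewrite <- IH.
Qed.

Lemma dir_fun_unique (a : nat -> C) (s l : C) : Clim (dpartial a s) l -> dir_fun a s = l.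
Proof.
  intros H. destruct l as [x y]. unfold dir_fun. f_equal; apply Series_of_rsum_lim.
  - eapply is_lim_seq_ext; [intros n; apply Re_dpartial|]. exact (Re_Clim _ _ H).
  - eapply is_lim_seq_ext; [intros n; apply Im_dpartial|]. exact (Im_Clim _ _ H).
Qed.

Lemma is_lim_seq_rsum (v : nat -> nat -> R) (l : nat -> R) (N : nat) :
  (forall k, is_lim_seq (fun j => v j k) (l k)) ->
  is_lim_seq (fun j => rsum (v j) N) (rsum l N).
Proof.
  intros H; induction N as [|N IH]; simpl; [apply is_lim_seq_const|].
  now apply is_lim_seq_plus'.
Qed.

Lemma is_lim_seq_inv_S : is_lim_seq (fun j => / INR (S j)) 0.
Proof.
  apply is_lim_seq_spec. intros e.
  destruct (nfloor_ex (/ e)) as [N [_ HN]]; [left; apply Rinv_0_lt_compat, cond_pos|].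
  exists N. intros n Hn. rewrite Rminus_0_r, Rabs_right.
  - rewrite <- (Rinv_inv e). assert (He := cond_pos e).
    apply Rinv_lt_contravar.
    + apply Rmult_lt_0_compat; [now apply Rinv_0_lt_compat|apply lt_0_INR; lia].
    + rewrite <- S_INR in HN. apply (Rlt_le_trans _ _ _ HN), le_INR. lia.
  - left; apply Rinv_0_lt_compat, lt_0_INR; lia.
Qed.

Lemma inv_S_small (e : R) : 0 < e -> exists J, forall j, (J <= j)%nat -> / INR (S j) < e.
Proof.
  intros He. assert (H := is_lim_seq_inv_S). apply is_lim_seq_spec in H.
  destruct (H (mkposreal e He)) as [J HJ]. exists J. intros j Hj.
  specialize (HJ j Hj). simpl pos in HJ. rewrite Rminus_0_r in HJ.
  eapply Rle_lt_trans; [apply Rle_abs|exact HJ].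
Qed.

Lemma is_lim_seq_weighted_sq (u : nat -> C) (l : C) (w : nat -> R) (m : R) :
  Clim u l -> is_lim_seq w m ->
  is_lim_seq (fun j => (Cmod (u j) * w j) ^ 2) ((Cmod l * m) ^ 2).
Proof.
  intros Hu Hw.
  assert (H := is_lim_seq_mult' _ _ _ _ (Cmod_Clim u l Hu) Hw).
  eapply is_lim_seq_ext; [|replace ((Cmod l * m) ^ 2) with (Cmod l * m * (Cmod l * m)) by ring;
    exact (is_lim_seq_mult' _ _ _ _ H H)].
  intros n; simpl; ring.
Qed.

(* The approximation of index [j] is taken within [1/(j+1)] on the half-plane
   [Re s > 1/(j+1)], so that one sequence serves all half-planes [Re s > eta]. *)
Lemma dirichlet_limit_approx (g : C -> C) :
  dirichlet_limit g ->
  exists (p : nat -> nat -> C) (D : nat -> nat),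
    forall j, (forall k, (D j <= k)%nat -> p j k = 0) /\
      forall s, / INR (S j) < Re s -> Cmod (dpartial (p j) s (D j) - g s) <= / INR (S j).
Proof.
  intros Hg.
  assert (H : forall j, exists q : (nat -> C) * nat,
    (forall k, (snd q <= k)%nat -> fst q k = 0) /\
    forall s, / INR (S j) < Re s -> Cmod (dpartial (fst q) s (snd q) - g s) <= / INR (S j)).
  { intros j. assert (He : 0 < / INR (S j)) by (apply Rinv_0_lt_compat, lt_0_INR; lia).
    destruct (Hg _ _ He He) as [f [[p [N [Hp HN]]] Hf]].
    exists (p, N). split; [easy|]. intros s Hs. simpl. rewrite <- HN. left. now apply Hf. }
  exists (fun j => fst (proj1_sig (constructive_indefinite_description _ (H j)))),
         (fun j => snd (proj1_sig (constructive_indefinite_description _ (H j)))).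
  intros j. exact (proj2_sig (constructive_indefinite_description _ (H j))).
Qed.

Lemma mean_square_le_finite_support (p : nat -> C) (D : nat) (sigma B : R) (N : nat) :
  (forall k, (D <= k)%nat -> p k = 0) ->
  (forall s, Re s = sigma -> Cmod (dpartial p s D) <= B) ->
  rsum (fun k => (Cmod (p k) * exp (- sigma * logS k)) ^ 2) N <= B ^ 2.
Proof.
  intros Hp HB. eapply Rle_trans; [apply (rsum_incr _ N (N + D)); [intros; apply pow2_ge_0|lia]|].
  apply mean_square_le. intros s Hs.
  rewrite (dpartial_finite_support p s D) by (try easy; lia). now apply HB.
Qed.

(** Mean squares of differences of approximants make each coefficient Cauchy; [b] collects the
    limits. The norm bound passes to the limit on finite sums, and Cauchy-Schwarz compares the
    partial sums of [b] with an approximant. *)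
Lemma bounded_dirichlet_limit_H2 (g : C -> C) (M : R) :
  dirichlet_limit g -> (forall s, 0 < Re s -> Cmod (g s) <= M) ->
  exists b, in_H2 b /\ H2norm b <= M /\ forall s, 1/2 < Re s -> dir_fun b s = g s.
Proof.
  intros Hg HM. destruct (dirichlet_limit_approx g Hg) as [p [D Hp]].
  set (e := fun j => / INR (S j)).
  assert (He : forall j, 0 < e j) by (intros; apply Rinv_0_lt_compat, lt_0_INR; lia).
  assert (HM0 : 0 <= M).
  { eapply Rle_trans; [apply Cmod_ge_0|apply (HM 1)]. simpl; lra. }
  assert (Hdiff : forall i j sigma N, e i < sigma -> e j < sigma ->
    rsum (fun k => (Cmod (p i k - p j k) * exp (- sigma * logS k)) ^ 2) N <= (e i + e j) ^ 2).
  { intros i j sigma N Hi Hj. destruct (Hp i) as [Zi Ai]. destruct (Hp j) as [Zj Aj].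
    apply (mean_square_le_finite_support (fun k => p i k - p j k)%C (D i + D j)).
    - intros k Hk. rewrite Zi, Zj by lia. ring.
    - intros s Hs. rewrite dpartial_minus.
      rewrite (dpartial_finite_support (p i) s (D i)), (dpartial_finite_support (p j) s (D j))
        by (try easy; lia).
      eapply Rle_trans; [apply (Cmod_minus_triangle _ (g s))|].
      rewrite (Cmod_minus_sym (g s)).
      apply Rplus_le_compat; [apply Ai|apply Aj]; rewrite Hs; easy. }
  assert (Hb : forall k, exists l, Clim (fun j => p j k) l).
  { intros k. apply Clim_cauchy. intros d Hd.
    destruct (inv_S_small (d / 2 * exp (- (2) * logS k))) as [J HJ].
    { apply Rmult_lt_0_compat; [lra|apply exp_pos]. }
    exists J. intros n m Hn Hm.
    (* Every [e j] is at most 1, so all approximants can be compared on the single line Re s = 2. *)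
    assert (He2 : forall j, e j < 2).
    { intros j. unfold e. eapply Rle_lt_trans; [|apply Rlt_plus_1 with (r := 1)].
      rewrite <- Rinv_1. apply Rinv_le_contravar; [lra|].
      rewrite S_INR. generalize (pos_INR j); lra. }
    assert (H := Hdiff n m 2 (S k) (He2 n) (He2 m)).
    assert (H1 : Cmod (p n k - p m k) * exp (- (2) * logS k) <= e n + e m).
    { apply sq_le_inv; [generalize (He n), (He m); lra|].
      eapply Rle_trans; [|apply H].
      apply (rsum_term_le (fun k => (Cmod (p n k - p m k) * exp (- (2) * logS k)) ^ 2));
        [intros; apply pow2_ge_0|lia]. }
    apply Rmult_lt_reg_r with (exp (- (2) * logS k)); [apply exp_pos|].
    eapply Rle_lt_trans; [apply H1|].
    assert (H2 := HJ n Hn). assert (H3 := HJ m Hm). unfold e. lra. }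
  set (b := fun k => proj1_sig (constructive_indefinite_description _ (Hb k))).
  assert (Hlim : forall k, Clim (fun j => p j k) (b k)).
  { intros k. exact (proj2_sig (constructive_indefinite_description _ (Hb k))). }
  clearbody b. clear Hb. exists b.
  assert (Hnorm : forall N, rsum (fun k => Cmod (b k) ^ 2) N <= M ^ 2).
  { intros N.
    (* The abscissa [2 * e j] lies inside the half-plane where approximant j is accurate, yet tends
       to 0, so the weights tend to 1. *)
    assert (HL : is_lim_seq (fun j => rsum (fun k => (Cmod (p j k) * exp (- (2 * e j) * logS k)) ^ 2) N)
                   (rsum (fun k => (Cmod (b k) * 1) ^ 2) N)).
    { apply is_lim_seq_rsum. intros k. apply is_lim_seq_weighted_sq; [apply Hlim|].
      rewrite <- exp_0. apply (is_lim_seq_continuous exp); [apply derivable_continuous, derivable_exp|].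
      replace 0 with (- (2 * logS k) * 0) by ring.
      apply (is_lim_seq_ext (fun j => - (2 * logS k) * e j)); [intros; ring|].
      apply is_lim_seq_mult'; [apply is_lim_seq_const|apply is_lim_seq_inv_S]. }
    assert (HR : is_lim_seq (fun j => (M + e j) ^ 2) (M ^ 2)).
    { replace (M ^ 2) with ((M + 0) * (M + 0)) by ring.
      apply (is_lim_seq_ext (fun j => (M + e j) * (M + e j))); [intros; ring|].
      apply is_lim_seq_mult'; apply is_lim_seq_plus';
        try apply is_lim_seq_const; apply is_lim_seq_inv_S. }
    rewrite (rsum_ext _ (fun k => (Cmod (b k) * 1) ^ 2)) by (intros; ring).
    refine (is_lim_seq_le _ _ _ _ _ HL HR). intros j.
    destruct (Hp j) as [Zj Aj].
    apply (mean_square_le_finite_support (p j) (D j)); [easy|].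
    intros s Hs. assert (Hej := He j).
    eapply Rle_trans; [apply (Cmod_le_minus _ (g s))|].
    apply Rplus_le_compat; [apply HM; lra|apply Aj; rewrite Hs; fold (e j); lra]. }
  (* Limit of [Hdiff] as j grows: [e j <= e i] for j >= i, hence the bound [2 * e i], uniform in
     [N]. *)
  assert (Hnear : forall i sigma N, e i < sigma ->
    rsum (fun k => (Cmod (p i k - b k) * exp (- sigma * logS k)) ^ 2) N <= (2 * e i) ^ 2).
  { intros i sigma N Hi.
    assert (HL : is_lim_seq (fun j => rsum (fun k => (Cmod (p i k - p j k) * exp (- sigma * logS k)) ^ 2) N)
                   (rsum (fun k => (Cmod (p i k - b k) * exp (- sigma * logS k)) ^ 2) N)).
    { apply is_lim_seq_rsum. intros k.
      apply is_lim_seq_weighted_sq; [|apply is_lim_seq_const].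
      intros d Hd. destruct (Hlim k d Hd) as [J HJ]. exists J. intros j Hj.
      replace (p i k - p j k - (p i k - b k))%C with (- (p j k - b k))%C by ring.
      rewrite Cmod_opp. now apply HJ. }
    apply (is_lim_seq_le_loc _ (fun _ => (2 * e i) ^ 2) _ ((2 * e i) ^ 2)) with (2 := HL);
      [|apply is_lim_seq_const].
    exists i. intros j Hj.
    assert (Hji : e j <= e i).
    { unfold e. apply Rinv_le_contravar; [apply lt_0_INR; lia|apply le_INR; lia]. }
    eapply Rle_trans; [apply Hdiff; lra|].
    apply pow_incr. generalize (He i), (He j); lra. }
  destruct (ex_series_rsum_bounded (fun k => Cmod (b k) ^ 2) (M ^ 2)) as [Hex HS];
    [intros; apply pow_le, Cmod_ge_0|easy|].
  split; [easy|]. split.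
  - unfold H2norm. rewrite <- (sqrt_pow2 M HM0). now apply sqrt_le_1_alt.
  - intros s Hs. apply dir_fun_unique. intros d Hd.
    (* Splits Re s = eta + (1/2 + eta): the first part weights the coefficient errors, as in
       [Hnear], and the second leaves a square-summable weight with sum [Z]. *)
    set (eta := (Re s - 1/2) / 2). assert (Heta : 0 < eta) by (unfold eta; lra).
    set (Z := Series (fun k => exp (- (Re s - eta) * logS k) ^ 2)).
    assert (HexZ : ex_series (fun k => exp (- (Re s - eta) * logS k) ^ 2)).
    { eapply ex_series_ext; [|apply (zeta_series (2 * eta)); lra].
      intros k. simpl. rewrite Rmult_1_r, <- exp_plus. f_equal. unfold eta; field. }
    assert (HZ : forall N, rsum (fun k => exp (- (Re s - eta) * logS k) ^ 2) N <= sqrt Z ^ 2).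
    { intros N. rewrite pow2_sqrt.
      - apply rsum_le_Series; [|easy]. intros; apply pow_le; left; apply exp_pos.
      - eapply Rle_trans; [|apply (rsum_le_Series _ 0); [|easy]]; [simpl; lra|].
        intros; apply pow_le; left; apply exp_pos. }
    assert (HZ0 := sqrt_pos Z).
    (* The total error is [e i] from approximating [g] plus [2 * e i * sqrt Z] from
       Cauchy-Schwarz. *)
    destruct (inv_S_small (Rmin eta (d / (2 * sqrt Z + 1)))) as [i Hi].
    { apply Rmin_glb_lt; [easy|]. apply Rdiv_lt_0_compat; lra. }
    specialize (Hi i (le_n _)). fold (e i) in Hi.
    assert (Hi1 : e i < eta) by (eapply Rlt_le_trans; [apply Hi|apply Rmin_l]).
    assert (Hi2 : e i < d / (2 * sqrt Z + 1)) by (eapply Rlt_le_trans; [apply Hi|apply Rmin_r]).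
    exists (D i). intros N HN. destruct (Hp i) as [Zi Ai].
    rewrite Cmod_minus_sym. eapply Rle_lt_trans; [apply (Cmod_minus_triangle _ (dpartial (p i) s N))|].
    assert (H1 : Cmod (g s - dpartial (p i) s N) <= e i).
    { rewrite Cmod_minus_sym, (dpartial_finite_support (p i) s (D i)) by easy.
      apply Ai. fold (e i). unfold eta in Hi1. lra. }
    assert (H2 : Cmod (dpartial (p i) s N - dpartial b s N) <= 2 * e i * sqrt Z).
    { rewrite <- dpartial_minus. eapply Rle_trans; [apply Cmod_dpartial_le|].
      rewrite (rsum_ext _ (fun k => (Cmod (p i k - b k) * exp (- eta * logS k))
                                    * exp (- (Re s - eta) * logS k))).
      - apply rsum_prod_le; [generalize (He i); lra|easy|now apply Hnear|apply HZ].
      - intros k _. rewrite Cmod_dterm, Rmult_assoc, <- exp_plus. do 2 f_equal. ring. }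
    apply (Rmult_lt_compat_r (2 * sqrt Z + 1)) in Hi2; [|lra].
    replace (d / (2 * sqrt Z + 1) * (2 * sqrt Z + 1)) with d in Hi2 by (field; lra). lra.
Qed.

(** * Termwise differentiation *)

(** With u = log n, powers of log n cost only an arbitrarily small power of n. Each induction step
    spends half of the exponent on one factor, u <= (2/d) exp (d u / 2). *)
Lemma pow_le_exp (j : nat) (d : R) :
  0 < d -> exists B, 0 <= B /\ forall u, 0 <= u -> u ^ j <= B * exp (d * u).
Proof.
  revert d; induction j as [|j IH]; intros d Hd.
  - exists 1. split; [lra|]. intros u Hu. simpl. rewrite Rmult_1_l, <- exp_0.
    apply exp_le_compat. nra.
  - destruct (IH (d / 2)) as [B [HB H]]; [lra|].
    assert (Hd' : 0 < 2 / d) by (apply Rdiv_lt_0_compat; lra).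
    exists (2 / d * B). split; [nra|]. intros u Hu.
    replace (d * u) with (d / 2 * u + d / 2 * u) by field. rewrite exp_plus.
    replace (2 / d * B * (exp (d / 2 * u) * exp (d / 2 * u)))
      with (2 / d * exp (d / 2 * u) * (B * exp (d / 2 * u))) by ring.
    simpl. apply Rmult_le_compat; [easy|now apply pow_le| |now apply H].
    assert (H1 := exp_ineq1_le (d / 2 * u)).
    replace u with (2 / d * (d / 2 * u)) at 1 by (field; lra).
    apply Rmult_le_compat_l; lra.
Qed.

Lemma log_weight_series (j : nat) (sigma : R) :
  1/2 < sigma -> ex_series (fun k => (logS k ^ j * exp (- sigma * logS k)) ^ 2).
Proof.
  (* Half of the margin absorbs the logarithms; the other half remains, as 2 (sigma - d) = 1 + 2
     d. *)
  intros Hs. set (d := (sigma - 1/2) / 2). assert (Hd : 0 < d) by (unfold d; lra).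
  destruct (pow_le_exp j d Hd) as [B [HB H]].
  apply (@ex_series_le R_AbsRing R_CompleteNormedModule _
           (fun k => B ^ 2 * exp (- (1 + 2 * d) * logS k))).
  - intros k. change (Rabs ((logS k ^ j * exp (- sigma * logS k)) ^ 2)
                      <= B ^ 2 * exp (- (1 + 2 * d) * logS k)).
    rewrite Rabs_right by (apply Rle_ge, pow2_ge_0).
    replace (- (1 + 2 * d) * logS k) with (- (sigma - d) * logS k + - (sigma - d) * logS k)
      by (unfold d; field).
    rewrite exp_plus.
    replace (B ^ 2 * (exp (- (sigma - d) * logS k) * exp (- (sigma - d) * logS k)))
      with ((B * exp (- (sigma - d) * logS k)) ^ 2) by ring.
    apply pow_incr. split.
    + apply Rmult_le_pos; [apply pow_le, logS_ge_0|left; apply exp_pos].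
    + replace (- (sigma - d) * logS k) with (d * logS k + - sigma * logS k) by ring.
      rewrite exp_plus, <- Rmult_assoc.
      apply Rmult_le_compat_r; [left; apply exp_pos|apply H, logS_ge_0].
  - apply (ex_series_scal_l (B ^ 2) (fun k => exp (- (1 + 2 * d) * logS k))).
    apply zeta_series; lra.
Qed.

Lemma H2_weighted_series (a : nat -> C) (w : nat -> R) :
  in_H2 a -> (forall k, 0 <= w k) -> ex_series (fun k => w k ^ 2) ->
  ex_series (fun k => Cmod (a k) * w k) /\
  Series (fun k => Cmod (a k) * w k) <= H2norm a * sqrt (Series (fun k => w k ^ 2)).
Proof.
  intros Ha Hw Hex.
  assert (Hsq : forall f, ex_series (fun k => f k ^ 2) -> forall N,
    rsum (fun k => f k ^ 2) N <= sqrt (Series (fun k => f k ^ 2)) ^ 2).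
  { intros f Hf N. rewrite pow2_sqrt.
    - apply (rsum_le_Series (fun k => f k ^ 2)); [intros; apply pow2_ge_0|easy].
    - apply (rsum_le_Series (fun k => f k ^ 2) 0); [intros; apply pow2_ge_0|easy]. }
  apply ex_series_rsum_bounded.
  - intros k. apply Rmult_le_pos; [apply Cmod_ge_0|easy].
  - intros N. apply rsum_prod_le; [apply sqrt_pos|apply sqrt_pos| |now apply Hsq].
    now apply (Hsq (fun k => Cmod (a k))).
Qed.

(** Weierstrass test. The tail bound depends on [t] alone, so one majorant valid for many [s] gives
    uniform convergence. The first conclusion certifies that the total function [dir_fun] is a
    genuine sum here. *)
Lemma dir_fun_dominated (a : nat -> C) (s : C) (t : nat -> R) :
  ex_series t -> (forall k, Cmod (dterm a s k) <= t k) ->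
  Clim (dpartial a s) (dir_fun a s) /\
  forall N, Cmod (dir_fun a s - dpartial a s N) <= Series t - rsum t N.
Proof.
  intros Ht H.
  assert (Ht0 : forall k, 0 <= t k).
  { intros k. eapply Rle_trans; [apply Cmod_ge_0|apply H]. }
  assert (Htail : forall N n, (N <= n)%nat ->
    Cmod (dpartial a s n - dpartial a s N) <= Series t - rsum t N).
  { intros N n Hn. eapply Rle_trans; [now apply Cmod_dpartial_minus_le|].
    apply Rle_trans with (rsum t n - rsum t N).
    - induction Hn as [|n _ IH]; cbn [rsum]; [lra|]. specialize (H n). lra.
    - assert (H1 := rsum_le_Series t n Ht0 Ht). lra. }
  assert (Hlim : Clim (dpartial a s) (dir_fun a s)).
  { destruct (Clim_cauchy (dpartial a s)) as [l Hl]; [|now rewrite (dir_fun_unique a s l Hl)].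
    intros e He. assert (H1 := is_lim_seq_rsum_series t Ht). apply is_lim_seq_spec in H1.
    destruct (H1 (mkposreal (e / 2) ltac:(lra))) as [N HN]. exists N. intros n m Hn Hm.
    specialize (HN N (le_n _)). simpl pos in HN. apply Rabs_def2 in HN.
    assert (Hn' := Htail N n Hn). assert (Hm' := Htail N m Hm).
    eapply Rle_lt_trans; [apply (Cmod_minus_triangle _ (dpartial a s N))|].
    rewrite (Cmod_minus_sym (dpartial a s N)). lra. }
  split; [easy|]. intros N. apply Rle_plus_epsilon. intros e He.
  destruct (Hlim e He) as [n Hn]. specialize (Hn (n + N)%nat ltac:(lia)).
  assert (Hn' := Htail N (n + N)%nat ltac:(lia)).
  eapply Rle_trans; [apply (Cmod_minus_triangle _ (dpartial a s (n + N)))|].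
  rewrite (Cmod_minus_sym (dir_fun a s)). lra.
Qed.

Definition derivative_coeff (a : nat -> C) (k : nat) : C := (a k * RtoC (- logS k))%C.

Lemma Cmod_dterm_derivative (a : nat -> C) (s : C) (k : nat) :
  Cmod (dterm (derivative_coeff a) s k) = Cmod (a k) * (logS k ^ 1 * exp (- Re s * logS k)).
Proof.
  unfold derivative_coeff. rewrite Cmod_dterm, Cmod_mult, Cmod_R, Rabs_Ropp, Rabs_right
    by (apply Rle_ge, logS_ge_0). ring.
Qed.

Lemma dir_fun_converges (a : nat -> C) (s : C) :
  in_H2 a -> 1/2 < Re s ->
  Clim (dpartial a s) (dir_fun a s) /\
  Clim (dpartial (derivative_coeff a) s) (dir_fun (derivative_coeff a) s).
Proof.
  intros Ha Hs.
  assert (Hw : forall j k, 0 <= logS k ^ j * exp (- Re s * logS k)).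
  { intros j k. apply Rmult_le_pos; [apply pow_le, logS_ge_0|left; apply exp_pos]. }
  split.
  - apply (dir_fun_dominated a s (fun k => Cmod (a k) * (logS k ^ 0 * exp (- Re s * logS k)))).
    + apply H2_weighted_series; [easy|apply Hw|now apply log_weight_series].
    + intros k. rewrite Cmod_dterm. simpl. lra.
  - apply (dir_fun_dominated _ s (fun k => Cmod (a k) * (logS k ^ 1 * exp (- Re s * logS k)))).
    + apply H2_weighted_series; [easy|apply Hw|now apply log_weight_series].
    + intros k. rewrite Cmod_dterm_derivative. lra.
Qed.

(** With z = -h log n the left side is the term at [w] times exp z - 1 - z. The factor exp |z| costs
    at most n^d, which moves the weight from Re w to Re w - d. *)
Lemma dterm_second_order (a : nat -> C) (w h : C) (d : R) (k : nat) :
  Cmod h <= d ->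
  Cmod (dterm a (w + h) k - dterm a w k - h * dterm (derivative_coeff a) w k)
  <= 4 * Cmod h ^ 2 * (Cmod (a k) * (logS k ^ 2 * exp (- (Re w - d) * logS k))).
Proof.
  intros Hh. set (z := (- h * RtoC (logS k))%C).
  assert (HL := logS_ge_0 k). assert (Hh0 := Cmod_ge_0 h).
  assert (Hz : Cmod z = Cmod h * logS k).
  { unfold z. rewrite Cmod_mult, Cmod_opp, Cmod_R, Rabs_right; lra. }
  replace (dterm a (w + h) k - dterm a w k - h * dterm (derivative_coeff a) w k)%C
    with (dterm a w k * (Cexp z - 1 - z))%C.
  2:{ unfold dterm, derivative_coeff. rewrite !npow_neg_Cexp.
      replace (- (w + h) * RtoC (ln (INR (S k))))%C
        with (- w * RtoC (ln (INR (S k))) + z)%C by (unfold z, logS; ring).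
      rewrite Cexp_plus. unfold z. rewrite RtoC_opp. ring. }
  rewrite Cmod_mult, Cmod_dterm.
  assert (H := Cexp_second_order z). rewrite Hz in H.
  assert (He : exp (Cmod h * logS k) <= exp (d * logS k)) by (apply exp_le_compat; nra).
  replace (- (Re w - d) * logS k) with (- Re w * logS k + d * logS k) by ring. rewrite exp_plus.
  assert (0 <= Cmod (a k) * exp (- Re w * logS k))
    by (apply Rmult_le_pos; [apply Cmod_ge_0|left; apply exp_pos]).
  replace (4 * Cmod h ^ 2 * (Cmod (a k) * (logS k ^ 2 * (exp (- Re w * logS k) * exp (d * logS k)))))
    with (Cmod (a k) * exp (- Re w * logS k) * (4 * (Cmod h * logS k) ^ 2 * exp (d * logS k))) by ring.
  apply Rmult_le_compat_l; [easy|]. eapply Rle_trans; [apply H|].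
  apply Rmult_le_compat_l; [|easy]. generalize (pow2_ge_0 (Cmod h * logS k)); lra.
Qed.

Lemma dir_fun_second_order (a : nat -> C) (w : C) :
  in_H2 a -> 1/2 < Re w ->
  exists d B, 0 < d /\ 0 <= B /\ forall h, Cmod h <= d ->
    Cmod (dir_fun a (w + h) - dir_fun a w - h * dir_fun (derivative_coeff a) w)
    <= B * Cmod h ^ 2.
Proof.
  (* Half the distance to the line Re = 1/2: [w + h] stays in the half-plane of convergence, and the
     weight at Re w - d is still square summable with its factor log^2 n. *)
  intros Ha Hw. set (d := (Re w - 1/2) / 2). assert (Hd : 0 < d) by (unfold d; lra).
  set (t := fun k => Cmod (a k) * (logS k ^ 2 * exp (- (Re w - d) * logS k))).
  assert (Ht0 : forall k, 0 <= t k).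
  { intros k. apply Rmult_le_pos; [apply Cmod_ge_0|].
    apply Rmult_le_pos; [apply pow2_ge_0|left; apply exp_pos]. }
  assert (Ht : ex_series t).
  { apply (H2_weighted_series a (fun k => logS k ^ 2 * exp (- (Re w - d) * logS k))); [easy| |].
    - intros k. apply Rmult_le_pos; [apply pow2_ge_0|left; apply exp_pos].
    - apply log_weight_series. unfold d. lra. }
  exists d, (4 * Series t). split; [easy|]. split.
  { generalize (rsum_le_Series t 0 Ht0 Ht). simpl. lra. }
  intros h Hh.
  assert (Hwh : 1/2 < Re (w + h)).
  { replace (Re (w + h)) with (Re w + Re h) by easy.
    assert (H := re_le_Cmod h). apply Rabs_le_between in H. unfold d in Hh. lra. }
  destruct (dir_fun_converges a w Ha Hw) as [H1 H2].
  destruct (dir_fun_converges a (w + h) Ha Hwh) as [H3 _].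
  assert (Hp : forall N,
    Cmod (dpartial a (w + h) N - dpartial a w N - h * dpartial (derivative_coeff a) w N)
    <= 4 * Series t * Cmod h ^ 2).
  { intros N. apply Rle_trans with (4 * Cmod h ^ 2 * rsum t N).
    - induction N as [|N IH]; cbn [dpartial rsum].
      + replace (0 - 0 - h * 0)%C with (RtoC 0) by ring. rewrite Cmod_0. lra.
      + assert (H4 := dterm_second_order a w h d N Hh). fold (t N) in H4.
        match goal with |- Cmod ?x <= _ => replace x with
          ((dpartial a (w + h) N - dpartial a w N - h * dpartial (derivative_coeff a) w N)
           + (dterm a (w + h) N - dterm a w N - h * dterm (derivative_coeff a) w N))%C by ring end.
        eapply Rle_trans; [apply Cmod_triangle|]. lra.
    - replace (4 * Series t * Cmod h ^ 2) with (4 * Cmod h ^ 2 * Series t) by ring.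
      apply Rmult_le_compat_l; [generalize (pow2_ge_0 (Cmod h)); lra|].
      now apply rsum_le_Series. }
  apply Rle_plus_epsilon. intros e He.
  (* Three partial sums are replaced by their limits, the one of the derivative being multiplied by
     [h]; the errors total (2 + |h|) q = e. *)
  set (q := e / (2 + Cmod h)). assert (Hh0 := Cmod_ge_0 h).
  assert (Hq : 0 < q) by (apply Rdiv_lt_0_compat; lra).
  destruct (H1 q Hq) as [N1 HN1]. destruct (H2 q Hq) as [N2 HN2].
  destruct (H3 q Hq) as [N3 HN3].
  set (N := (N1 + N2 + N3)%nat).
  specialize (HN1 N ltac:(unfold N; lia)). specialize (HN2 N ltac:(unfold N; lia)).
  specialize (HN3 N ltac:(unfold N; lia)). specialize (Hp N).
  rewrite Cmod_minus_sym in HN3.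
  match goal with |- Cmod ?x <= _ => replace x with
    ((dpartial a (w + h) N - dpartial a w N - h * dpartial (derivative_coeff a) w N)
     + ((dir_fun a (w + h) - dpartial a (w + h) N) + (dpartial a w N - dir_fun a w)
     + h * (dpartial (derivative_coeff a) w N - dir_fun (derivative_coeff a) w)))%C by ring end.
  eapply Rle_trans; [apply Cmod_triangle|]. apply Rplus_le_compat; [easy|].
  eapply Rle_trans; [apply Cmod_triangle|]. rewrite Cmod_mult.
  assert (H5 := Cmod_triangle (dir_fun a (w + h) - dpartial a (w + h) N)
    (dpartial a w N - dir_fun a w)).
  assert (H6 : Cmod h * Cmod (dpartial (derivative_coeff a) w N - dir_fun (derivative_coeff a) w)
    <= Cmod h * q) by (apply Rmult_le_compat_l; lra).
  replace e with (2 * q + Cmod h * q) by (unfold q; field; lra). lra.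
Qed.

Lemma Cplus_minus (x y : C) : (x + (y - x) = y)%C.
Proof.
  ring.
Qed.

Lemma is_derive_dir_fun (a : nat -> C) (w : C) :
  in_H2 a -> 1/2 < Re w ->
  @is_derive C_AbsRing C_NormedModule (dir_fun a) w (dir_fun (derivative_coeff a) w).
Proof.
  intros Ha Hw. destruct (dir_fun_second_order a w Ha Hw) as [d [B [Hd [HB H]]]].
  split; [apply is_linear_scal_l|].
  intros x Hx.
  (* The differential is required at every limit point of the filter [locally w]; the only one is
     [w]. *)
  apply (@is_filter_lim_locally_unique C_AbsRing (AbsRing_NormedModule C_AbsRing)) in Hx.
  subst x. intros e.
  assert (He := cond_pos e).
  (* Within this radius B |h|^2 <= e |h|; the [+ 1] covers [B = 0]. *)
  assert (Hr : 0 < Rmin d (e / (B + 1))).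
  { apply Rmin_glb_lt; [easy|]. apply Rdiv_lt_0_compat; lra. }
  exists (mkposreal _ Hr). intros y Hy.
  change (Cmod (y - w) < Rmin d (e / (B + 1))) in Hy.
  change (Cmod (dir_fun a y - dir_fun a w - (y - w) * dir_fun (derivative_coeff a) w)
          <= e * Cmod (y - w)).
  assert (H1 := Rlt_le_trans _ _ _ Hy (Rmin_l _ _)).
  assert (H2 := Rlt_le_trans _ _ _ Hy (Rmin_r _ _)).
  specialize (H (y - w)%C (Rlt_le _ _ H1)).
  rewrite Cplus_minus in H.
  eapply Rle_trans; [apply H|]. assert (H0 := Cmod_ge_0 (y - w)).
  apply (Rmult_lt_compat_r (B + 1)) in H2; [|lra].
  replace (e / (B + 1) * (B + 1)) with (pos e) in H2 by (field; lra).
  nra.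
Qed.

(** * The composed derivative as an element of the Hardy space *)

Theorem theorem2p4 (c : nat -> C) (Phi : C -> C) :
  in_G0 c Phi ->
  (exists eps : R, 0 < eps /\ forall s : C, 0 < Re s -> 1/2 + eps < Re (Phi s)) ->
  exists K : R, 0 <= K /\
    forall a : nat -> C, in_H2 a ->
      exists b : nat -> C,
        in_H2 b /\ H2norm b <= K * H2norm a /\
        forall s : C, 1/2 < Re s ->
          @is_derive C_AbsRing C_NormedModule (dir_fun a) (Phi s) (dir_fun b s).
Proof.
  intros HG [eps [Heps HPhi]].
  (* The modulus of the differentiated n^{-z} on the line Re z = 1/2 + eps, which dominates it at
     every [Phi s]. *)
  set (w := fun k => logS k ^ 1 * exp (- (1/2 + eps) * logS k)).
  assert (Hw0 : forall k, 0 <= w k).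
  { intros k. apply Rmult_le_pos; [apply pow_le, logS_ge_0|left; apply exp_pos]. }
  exists (sqrt (Series (fun k => w k ^ 2))). split; [apply sqrt_pos|]. intros a Ha.
  destruct (H2_weighted_series a w Ha Hw0) as [Ht HK]; [apply log_weight_series; lra|].
  set (t := fun k => Cmod (a k) * w k) in *.
  (* One estimate serves twice: large [N] gives uniform approximation by partial sums composed with
     [Phi], and [N = 0] gives the sup bound. *)
  assert (Hdom : forall s, 0 < Re s -> forall N,
    Cmod (dir_fun (derivative_coeff a) (Phi s) - dpartial (derivative_coeff a) (Phi s) N)
    <= Series t - rsum t N).
  { intros s Hs. apply dir_fun_dominated; [easy|]. intros k.
    rewrite Cmod_dterm_derivative. unfold t, w.
    apply Rmult_le_compat_l; [apply Cmod_ge_0|].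
    apply Rmult_le_compat_l; [apply pow_le, logS_ge_0|].
    apply exp_le_compat. specialize (HPhi s Hs). generalize (logS_ge_0 k). nra. }
  destruct (bounded_dirichlet_limit_H2 (fun s => dir_fun (derivative_coeff a) (Phi s))
              (sqrt (Series (fun k => w k ^ 2)) * H2norm a)) as [b [Hb [Hnorm Heq]]].
  - apply dirichlet_limit_closed. intros eta e Heta He.
    assert (H1 := is_lim_seq_rsum_series t Ht). apply is_lim_seq_spec in H1.
    destruct (H1 (mkposreal e He)) as [N HN]. specialize (HN N (le_n _)).
    simpl pos in HN. apply Rabs_def2 in HN.
    exists (fun s => dpartial (derivative_coeff a) (Phi s) N). split.
    + apply dirichlet_limit_dpartial_comp. now apply (in_G0_dirichlet_limit c).
    + intros s Hs. rewrite Cmod_minus_sym.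
      eapply Rle_lt_trans; [apply Hdom; lra|]. lra.
  - intros s Hs. specialize (Hdom s Hs 0%nat). simpl in Hdom.
    replace (dir_fun (derivative_coeff a) (Phi s) - 0)%C
      with (dir_fun (derivative_coeff a) (Phi s)) in Hdom by ring.
    rewrite Rminus_0_r in Hdom. lra.
  - exists b. split; [easy|]. split; [easy|]. intros s Hs. rewrite Heq by easy.
    apply is_derive_dir_fun; [easy|]. specialize (HPhi s ltac:(lra)). lra.
Qed.
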